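(* For $r=1$, the following holds almost surely. (1) For any $\delta>0$ and $0\le k\le d$, define the open interval $I_{k,\delta}=(2^{-k}-\delta,\,2^{-k}+\delta)$. Then $$\lim_{n\to\infty}\mu_n(I_{k,\delta})\ \ge\ \binom{d}{k}.$$ (2) Let $I\subset\mathbb{R}\setminus[-0.3,0.3]$. Then $$\lim_{n\to\infty}\mu_n(I)=\delta_1(I)+d\,\delta_{1/2}(I).$$
   Context: Let $d\ge 1$ be the dimension. Let $X_1,X_2,\ldots$ be i.i.d. uniformly distributed random points in $[-1,1]^d$, and let $\|x\|=\max_{1\le k\le d}|x_k|$ for $x=(x_1,\ldots,x_d)\in\mathbb{R}^d$. For fixed $r>0$ (independent of $n$) let $h_r(x,y)=1$ if $\|x-y\|\le r$ and $h_r(x,y)=0$ otherwise. Let $A_{n,r}$ be the $n\times n$ adjacency matrix of the random geometric graph on $X_1,\ldots,X_n$, with entries $(A_{n,r})_{i,j}=h_r(X_i,X_j)$, let $D_{n,r}=\mathrm{diag}(d_1,\ldots,d_n)$ with $d_i=\sum_{j}(A_{n,r})_{i,j}$, and let $W_{n,r}=D_{n,r}^{-1/2}A_{n,r}D_{n,r}^{-1/2}$ (that is, the identity minus the symmetrically normalized graph Laplacian). Let $\lambda^{(n)}_1\ge\lambda^{(n)}_2\ge\cdots\ge\lambda^{(n)}_n$ be the eigenvalues of $W_{n,r}$, and let $\mu_n=\sum_{i=1}^n\delta_{\lambda^{(n)}_i}$ be the (unnormalized) empirical eigenvalue measure, where $\delta_x$ denotes the Dirac delta measure at $x\in\mathb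b{R}$.
   Formalization: In (2), I must not have 1/2 on its topological boundary; in (1), liminf ≥ C(d,k) is shown for every δ, and the limit is claimed to exist only if no endpoint of I_{k,δ} lies in a fixed exceptional set that is finite away from 0. *)

(* Defs.v *)
From HB Require Import structures.
From mathcomp Require Import all_boot all_order all_algebra.
From mathcomp Require Import all_classical all_reals all_analysis.
From mathcomp Require complex.

Set Implicit Arguments.
Unset Strict Implicit.
Unset Printing Implicit Defensive.

Import Order.TTheory GRing.Theory Num.Theory.
Import numFieldNormedType.Exports.

Local Open Scope classical_set_scope.
Local Open Scope ring_scope.

Section cube.
Context {R : realType}.

Lemma ltN11R : (-1 : R) < 1.
Proof. by rewrite -subr_gt0 opprK addr_gt0. Qed.

Definition tuple_cons d (p : R * d.-tuple R) : d.+1.-tuple R :=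
  [tuple of p.1 :: p.2].

Lemma measurable_tuple_cons d :
  measurable_fun [set: measurableTypeR R * d.-tuple (measurableTypeR R)]
    (@tuple_cons d : _ -> d.+1.-tuple (measurableTypeR R)).
Proof. exact: measurable_cons. Qed.

HB.instance Definition _ d :=
  isMeasurableFun.Build _ _ _ _
    (@tuple_cons d : measurableTypeR R * d.-tuple (measurableTypeR R) ->
                     d.+1.-tuple (measurableTypeR R))
    (@measurable_tuple_cons d).

(* The product of [d] copies of the uniform law on [-1,1]. *)
Fixpoint uniform_cube d : probability (d.-tuple (measurableTypeR R)) R :=
  match d with
  | 0 => \d_[tuple]
  | d'.+1 => distribution (uniform_prob ltN11R \x uniform_cube d')%E
               (@tuple_cons d')
  end.

End cube.

Definition is_spectrum (R : realType) n (A : 'M[R]_n) (s : seq R) : Prop :=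
  sorted >=%R s /\ char_poly A = \prod_(x <- s) ('X - x%:P).

(* The eigenvalues of [A] with multiplicity, in nonincreasing order. By
   [spectrumP] the default value [::] is not used when [A] is symmetric. *)
Definition spectrum (R : realType) n (A : 'M[R]_n) : seq R :=
  xget [::] [set s | is_spectrum A s].

Lemma is_spectrum_uniq (R : realType) n (A : 'M[R]_n) s t :
  is_spectrum A s -> is_spectrum A t -> s = t.
Proof.
move=> [ss cs] [st ct]; apply: (sorted_eq ge_trans ge_anti ss st).
by apply: prod_XsubC_eq; rewrite -cs -ct.
Qed.

Section SpectrumExistence.
Import complex.

Lemma spectrumP (R : realType) n (A : 'M[R]_n) :
  A^T = A -> is_spectrum A (spectrum A).
Proof.
move=> symA; rewrite /spectrum; apply: (xgetPex [::]).
pose C : numClosedFieldType := complex.complex R.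
pose toC : {rmorphism R -> C} := complex.real_complex_def (Phant R).
pose B : 'M[C]_n := map_mx toC A.
have toC_real x : toC x \is Num.real by apply/complex.complex_realP; exists x.
have Bh : B \is hermsymmx.
  apply/is_hermitianmxP; rewrite expr0 scale1r; apply/matrixP => i j.
  by rewrite !mxE conj_Creal// -[in RHS]symA mxE.
have /orthomx_spectralP BE := hermitian_normalmx Bh.
have /mxOverP Dr := hermitian_spectral_diag_real Bh.
set D := spectral_diag B in BE Dr.
set Q := spectralmx B in BE.
have Qu : Q \in unitmx by exact: spectral_unit.
have cB : char_poly B = \prod_(i < n) ('X - (D 0 i)%:P).
  transitivity (char_poly (diag_mx D)).
    rewrite /char_poly /char_poly_mx BE.
    have -> : ('X%:M - map_mx polyC (invmx Q *m diag_mx D *m Q)) =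
        map_mx polyC (invmx Q) *m ('X%:M - map_mx polyC (diag_mx D))
          *m map_mx polyC Q.
      have QVQ : map_mx polyC (invmx Q) *m map_mx polyC Q = 1%:M.
        by rewrite -map_mxM mulVmx// map_mx1.
      rewrite mulmxBr mulmxBl !map_mxM; congr (_ - _).
      by rewrite scalar_mxC -mulmxA QVQ mulmx1.
    rewrite !det_mulmx mulrC mulrA -det_mulmx -map_mxM mulmxV// map_mx1 det1.
    by rewrite mul1r.
  rewrite char_poly_trig; last exact/diag_mx_is_trig.
  by apply: eq_bigr => i _; rewrite mxE eqxx mulr1n.
pose s := [seq complex.Re (D 0 i) | i : 'I_n].
exists (sort >=%R s); split; first exact/sort_sorted/ge_total.
apply: (map_poly_inj toC); rewrite map_char_poly -/B cB.
rewrite (perm_big s) /=; last by rewrite perm_sort.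
rewrite big_map big_enum /= rmorph_prod; apply: eq_bigr => i _.
rewrite rmorphB /= map_polyX map_polyC /=; congr (_ - _%:P).
by have /complex.complex_realP [x ->] := Dr 0 i.
Qed.
End SpectrumExistence.

Definition frontier (T : topologicalType) (A : set T) : set T :=
  closure A `&` closure (~` A).

Definition half_pow_itv (R : realType) (k : nat) (delta : R) : set R :=
  `]2 ^- k - delta, 2 ^- k + delta[%classic.

Section iid.
Local Open Scope ereal_scope.
Context (R : realType) (dO : measure_display) (Omega : measurableType dO)
  (P : probability Omega R) (dT : measure_display) (T : measurableType dT).

Definition mutually_independent (X : nat -> {RV P >-> T}) : Prop :=
  forall (s : seq nat) (B : nat -> set T), uniq s ->
    (forall i, measurable (B i)) ->
    P (\bigcap_(i in [set` s]) X i @^-1` B i) =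
    \prod_(i <- s) P (X i @^-1` B i).

Definition iid (mu : probability T R) (X : nat -> {RV P >-> T}) : Prop :=
  mutually_independent X /\
  forall i (B : set T), measurable B -> distribution P (X i) B = mu B.

End iid.

Section geometric_graph.
Context (R : realType) (d : nat).
Implicit Types (r : R) (p : nat -> d.-tuple R).

Definition sup_dist (x y : d.-tuple R) : R :=
  \big[Num.max/0]_(k < d) `|tnth x k - tnth y k|.

Definition adjacency r p n : 'M[R]_n :=
  \matrix_(i, j) (sup_dist (p i) (p j) <= r)%R%:R.

Definition degree r p n (i : 'I_n) : R := \sum_j adjacency r p n i j.

(* D^{-1/2} *)
Definition inv_sqrt_degree r p n : 'M[R]_n :=
  diag_mx (\row_i (Num.sqrt (degree r p i))^-1).

Definition normalized_adjacency r p n : 'M[R]_n :=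
  inv_sqrt_degree r p n *m adjacency r p n *m inv_sqrt_degree r p n.

Lemma normalized_adjacency_sym r p n :
  (normalized_adjacency r p n)^T = normalized_adjacency r p n.
Proof.
have symA : (adjacency r p n)^T = adjacency r p n.
  apply/matrixP => i j; rewrite !mxE; congr (_ <= r)%R%:R.
  by apply: eq_bigr => k _; rewrite distrC.
by rewrite /normalized_adjacency !trmx_mul tr_diag_mx symA mulmxA.
Qed.

Definition eigenvalue_measure r p n (I : set R) : \bar R :=
  (\sum_(x <- spectrum (normalized_adjacency r p n)) \d_x I)%E.

End geometric_graph.

(* Main.v *)
Require Import Defs.
From HB Require Import structures.
From mathcomp Require Import all_boot all_order all_algebra finmap.
From mathcomp Require Import all_classical all_reals all_analysis.
From mathcomp Require Import measurable_realfun ring lra zify.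
From mathcomp Require complex.

(** The eigenvalues of the random matrix W_n are compared with those of
explicit deterministic matrices, through traces of powers.

Reference matrix. Put 2N+1 points on a line and join two points when their
indices differ by at most N. The neighbours of a point form an interval of
indices whose mean is halfway between the point and the centre, so the random
walk on this graph has the eigenvector 1 with eigenvalue 1 and the centred
coordinate as eigenvector with eigenvalue 1/2, exactly and for every N. The
squares of all eigenvalues add up to the trace of the square of the walk, which
for large N is at most 1 + 1/4 + 0.299^2; this is a comparison with a block sum
that is evaluated by computation (its limit is
4 (ln 2)^2 - 2 \int_0^1 ln(1+x)/(2-x) dx = 1.3327...). Hence all other
eigenvalues are at most 0.299 in absolute value [band_spectrumP]. For the
max-norm the walk in dimension d is the d-fold tensor power, so its eigenvalues
are the d-fold products: 1 once, 1/2 exactly d times, 2^-k at least 'C(d, k)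
times, and everything except 1 and 1/2 of absolute value at most 0.299
[tensor_count, tensor_spectrumP].

Comparison. Cut [-1, 1] into 2N+1 equal cells. Whether two points are within
distance 1 is decided by their cells unless the cell indices differ by N or N+1
in some coordinate, which happens for a proportion O(1/N) of the pairs. So if
the cell frequencies of the sample are close to uniform, the entrywise L1
distance between the walk on the sample and the walk on the cells, divided by the
number of points, is O(1/N), and therefore so is the distance between the traces of any fixed power m >= 2
[graph_power_sum_dist]. The strong law of large numbers for the countably many
cells makes almost every sample equidistributed
[iid_uniform_equidistributed]. For such a sample the power sums of order m >= 2
of the spectrum of W_n and of the reference spectra converge to the same limits
[equidistributed_moments].

From power sums to counts. As the sums of squares stay bounded, convergence of
the power sums of order >= 2 implies, by polynomial approximation of f(x)/x^2,
convergence of the sums of f over the spectrum for every Lipschitz function f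
that vanishes near 0, with the same limit for both families of spectra
[lipschitz_moment_approx, plateau_sum_transfer]. With plateau functions f, gaps
and integer counts in the reference spectra carry over to the spectrum of W_n.
The exceptional set S consists of 0 and of the accumulation points of the
reference spectra. *)

Set Implicit Arguments.
Unset Strict Implicit.
Unset Printing Implicit Defensive.

Import Order.TTheory GRing.Theory Num.Theory.
Import numFieldNormedType.Exports.

Local Open Scope classical_set_scope.
Local Open Scope ring_scope.

(** * Powers and traces of kernels on finite types *)

Section kernel_powers.
Variable R : realFieldType.

(** Kernels are functions on arbitrary finite types rather than matrices: the
cells of the cube are indexed by finite functions, and a matrix would need an
enumeration of them. *)
Fixpoint kpow (T : finType) (K : T -> T -> R) m (x y : T) : R :=
  if m is m'.+1 then \sum_z K x z * kpow K m' z y else (x == y)%:R.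

Definition ktrace (T : finType) (K : T -> T -> R) m := \sum_x kpow K m x x.

Lemma kpow1 (T : finType) (K : T -> T -> R) x y : kpow K 1 x y = K x y.
Proof.
rewrite /= (bigD1 y)//= eqxx mulr1 big1 ?addr0// => z /negbTE ->.
by rewrite mulr0.
Qed.

Lemma kpowSr (T : finType) (K : T -> T -> R) m x y :
  kpow K m.+1 x y = \sum_z kpow K m x z * K z y.
Proof.
elim: m x y => [|m IH] x y.
  rewrite kpow1 (bigD1 x)//= eqxx mul1r big1 ?addr0// => z.
  by rewrite eq_sym => /negbTE ->; rewrite mul0r.
rewrite [LHS]/=.
under eq_bigr do rewrite -/(kpow K m.+1 _ _) IH mulr_sumr.
rewrite exchange_big/=; apply: eq_bigr => z _.
by rewrite mulr_suml; apply: eq_bigr => t _; rewrite mulrA.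
Qed.

Lemma eq_kpow (T : finType) (K K' : T -> T -> R) m x y :
  (forall x y, K x y = K' x y) -> kpow K m x y = kpow K' m x y.
Proof.
move=> KK; elim: m x y => //= m IH x y.
by apply: eq_bigr => z _; rewrite KK IH.
Qed.

Lemma eq_ktrace (T : finType) (K K' : T -> T -> R) m :
  (forall x y, K x y = K' x y) -> ktrace K m = ktrace K' m.
Proof. by move=> KK; apply: eq_bigr => x _; exact: eq_kpow. Qed.

(** This passes from the symmetric normalization of an adjacency matrix to the
random walk, whose entries contain no square roots. *)
Lemma ktrace_conj (T : finType) (K : T -> T -> R) (u : T -> R) m :
  (forall x, u x != 0) -> ktrace (fun x y => u x * K x y / u y) m = ktrace K m.
Proof.
move=> u0; apply: eq_bigr => x _.
suff -> : forall y, kpow (fun x y => u x * K x y / u y) m x y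
    = u x * kpow K m x y / u y by rewrite mulrC mulKf.
elim: m x => [|m IH] x y /=.
  by case: eqVneq => [->|]; rewrite ?mulr1 ?divff// mulr0 mul0r.
rewrite mulr_sumr mulr_suml; apply: eq_bigr => z _.
by rewrite IH; field; rewrite !u0.
Qed.

(** A walk on a product space is a tuple of independent walks, and a sum of
products over all tuples is the product of the sums. *)
Lemma kpow_prod (T : finType) d (K : T -> T -> R) m (x y : {ffun 'I_d -> T}) :
  kpow (fun x y : {ffun 'I_d -> T} => \prod_l K (x l) (y l)) m x y =
  \prod_l kpow K m (x l) (y l).
Proof.
elim: m x y => [|m IH] x y /=.
  case: eqVneq => [->|xy].
    by rewrite big1// => i _; rewrite eqxx.
  have [l ll] : exists l, x l != y l.
    apply/existsP; apply: contraNT xy => /existsPn h.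
    by apply/eqP/ffunP => l; apply/eqP; rewrite -[_ == _]negbK h.
  by rewrite (bigD1 l)//= (negbTE ll) mul0r.
under eq_bigr do rewrite IH -big_split/=.
by rewrite (bigA_distr_bigA (fun l z => K (x l) z * kpow K m z (y l))).
Qed.

Lemma ktrace_prod (T : finType) d (K : T -> T -> R) m :
  ktrace (fun x y : {ffun 'I_d -> T} => \prod_l K (x l) (y l)) m =
  ktrace K m ^+ d.
Proof.
rewrite /ktrace; under eq_bigr do rewrite kpow_prod.
rewrite -(bigA_distr_bigA (fun (l : 'I_d) z => kpow K m z z)).
by rewrite prodr_const card_ord.
Qed.

Lemma sum_lump (T U : finType) (c : U -> T) (a : R) (F : T -> R) :
  \sum_i a * F (c i) = \sum_x (\sum_i (c i == x)%:R * a) * F x.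
Proof.
under [RHS]eq_bigr do rewrite mulr_suml.
rewrite exchange_big/=; apply: eq_bigr => i _.
rewrite (bigD1 (c i))//= eqxx mul1r big1 ?addr0// => x.
by rewrite eq_sym => /negbTE ->; rewrite !mul0r.
Qed.

(** A kernel on [U] that sees a point only through its class [c i] has the trace
of a kernel on the classes, in which the column [y] is weighted by the mass of
the class [y]; this is the cyclicity of the trace. *)
Lemma ktrace_lump (T U : finType) (c : U -> T) (M : T -> T -> R) (a : R) m :
  ktrace (fun i j => a * M (c i) (c j)) m.+1 =
  ktrace (fun x y => M x y * (\sum_i (c i == y)%:R * a)) m.+1.
Proof.
set q := fun y => \sum_i (c i == y)%:R * a.
set E := fun x y => M x y * q y.
have key i j k : kpow (fun i j => a * M (c i) (c j)) k.+1 i j =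
    a * \sum_y kpow E k (c i) y * M y (c j).
  elim: k i j => [|k IH] i j.
    rewrite kpow1 (bigD1 (c i))//= eqxx mul1r big1 ?addr0// => y.
    by rewrite eq_sym => /negbTE ->; rewrite mul0r.
  rewrite [LHS]/=; under eq_bigr do rewrite -/(kpow _ k.+1 _ _) IH.
  under eq_bigr do rewrite -mulrA; rewrite -mulr_sumr; congr (_ * _).
  rewrite (eq_bigr (fun z => a * (M (c i) (c z) *
     \sum_y kpow E k (c z) y * M y (c j)))); last by move=> z _; ring.
  rewrite (sum_lump c a (fun x => M (c i) x * \sum_y kpow E k x y * M y (c j))).
  under [RHS]eq_bigr do rewrite /= mulr_suml.
  rewrite [RHS]exchange_big/=; apply: eq_bigr => x _.
  by rewrite -/(q x) mulrA mulr_sumr; apply: eq_bigr => y _; rewrite /E; ring.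
rewrite /ktrace; under eq_bigr do rewrite key.
rewrite (sum_lump c a (fun x => \sum_y kpow E m x y * M y x)); apply: eq_bigr => x _.
by rewrite kpowSr -/(q x) mulr_sumr; apply: eq_bigr => y _; rewrite /E; ring.
Qed.

Section comparison.
Variables (T : finType) (K K' : T -> T -> R) (c C : R).
Hypotheses (c0 : 0 <= c) (cC : c * #|T|%:R <= C).

Lemma sum_le_card (F : T -> R) : (forall x, F x <= c) -> \sum_x F x <= C.
Proof.
move=> h; apply: le_trans cC; apply: le_trans (_ : \sum_(x : T) c <= _).
  exact: ler_sum.
by rewrite sumr_const mulr_natr.
Qed.

Let C0 : 0 <= C.
Proof. by apply: le_trans cC; rewrite mulr_ge0. Qed.

(** A power of a kernel with entries of order 1/#|T| has entries of order 1/#|T|: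
one factor gives the size, the others only contribute row sums. *)
Lemma kpow_bound (G : T -> T -> R) m x y :
  (forall x y, `|G x y| <= c) -> `|kpow G m.+1 x y| <= c * C ^+ m.
Proof.
move=> h; elim: m x y => [|m IH] x y.
  by rewrite kpow1 expr0 mulr1.
rewrite [kpow _ _ _ _]/=; apply: le_trans (ler_norm_sum _ _ _) _.
apply: le_trans (_ : \sum_z `|G x z| * (c * C ^+ m) <= _).
  by apply: ler_sum => z _; rewrite normrM ler_wpM2l ?IH.
rewrite -mulr_suml exprS [leRHS]mulrCA ler_wpM2r ?mulr_ge0 ?exprn_ge0//.
by apply: sum_le_card.
Qed.

Hypotheses (Kc : forall x y, `|K x y| <= c) (K'c : forall x y, `|K' x y| <= c).

Let D := \sum_x \sum_y `|K x y - K' x y|.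

(** Replacing the factors of the product one after the other: each replacement
costs the L1 distance of the kernels, and the remaining factors have row and
column sums at most [C]. *)
Lemma kpow_l1_dist m :
  \sum_x \sum_y `|kpow K m.+1 x y - kpow K' m.+1 x y| <= m.+1%:R * C ^+ m * D.
Proof.
have D0 : 0 <= D by apply: sumr_ge0 => x _; apply: sumr_ge0.
elim: m => [|m IH].
  rewrite expr0 !mul1r; apply: ler_sum => x _; apply: ler_sum => y _.
  by rewrite !kpow1.
have Crow x : \sum_y `|kpow K m.+1 x y| <= C ^+ m.+1.
  apply: le_trans (_ : \sum_(y : T) c * C ^+ m <= _).
    by apply: ler_sum => y _; exact: kpow_bound.
  rewrite -mulr_suml exprS ler_wpM2r ?exprn_ge0//; exact: sum_le_card.
apply: le_trans (_ : \sum_x \sum_y \sum_z (`|K x z - K' x z| * `|kpow K m.+1 z y|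
   + `|K' x z| * `|kpow K m.+1 z y - kpow K' m.+1 z y|) <= _).
  apply: ler_sum => x _; apply: ler_sum => y _.
  rewrite [kpow K m.+2 x y]/= [kpow K' m.+2 x y]/= -sumrB.
  apply: le_trans (ler_norm_sum _ _ _) _; apply: ler_sum => z _.
  rewrite -!normrM; apply: le_trans (ler_normD _ _).
  rewrite -/(kpow K m.+1 z y) -/(kpow K' m.+1 z y).
  by rewrite le_eqVlt; apply/orP; left; apply/eqP; congr (`|_|); ring.
have -> : m.+2%:R * C ^+ m.+1 * D
   = C ^+ m.+1 * D + C * (m.+1%:R * C ^+ m * D).
  by rewrite -[m.+2]addn1 natrD exprS; ring.
under eq_bigr do under eq_bigr do rewrite big_split/=.
under eq_bigr do rewrite big_split/=.
rewrite big_split/=; apply: lerD.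
  rewrite /D mulr_sumr; apply: ler_sum => x _.
  rewrite exchange_big/= mulr_sumr; apply: ler_sum => z _.
  by rewrite -mulr_sumr mulrC ler_wpM2r ?Crow.
apply: le_trans (_ : C * (\sum_z \sum_y
    `|kpow K m.+1 z y - kpow K' m.+1 z y|) <= _); last by rewrite ler_wpM2l.
rewrite mulr_sumr.
under eq_bigr do rewrite exchange_big/=.
rewrite exchange_big/=; apply: ler_sum => z _.
under eq_bigr do rewrite -mulr_sumr.
rewrite -mulr_suml ler_wpM2r//; first exact: sumr_ge0.
by apply: sum_le_card.
Qed.

(** Traces of powers of order at least 2 are continuous for the L1 distance of
kernels, uniformly in the size of [T]. A trace of order 1 would not be: the
diagonal is invisible in the L1 norm. In a product of at least two factors the
remaining factors supply a bound of order 1/#|T| on every entry. *)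
Lemma ktrace_dist m :
  `|ktrace K m.+2 - ktrace K' m.+2| <= m.+2%:R * c * C ^+ m * D.
Proof.
have D0 : 0 <= D by apply: sumr_ge0 => x _; apply: sumr_ge0.
rewrite /ktrace -sumrB; apply: le_trans (ler_norm_sum _ _ _) _.
apply: le_trans (_ : \sum_x \sum_z (`|K x z - K' x z| * (c * C ^+ m)
   + c * `|kpow K m.+1 z x - kpow K' m.+1 z x|) <= _).
  apply: ler_sum => x _; rewrite [kpow K m.+2 x x]/= [kpow K' m.+2 x x]/= -sumrB.
  apply: le_trans (ler_norm_sum _ _ _) _; apply: ler_sum => z _.
  rewrite -/(kpow K m.+1 z x) -/(kpow K' m.+1 z x).
  apply: le_trans (_ : `|K x z - K' x z| * `|kpow K m.+1 z x| +
    `|K' x z| * `|kpow K m.+1 z x - kpow K' m.+1 z x| <= _).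
    rewrite -!normrM; apply: le_trans (ler_normD _ _).
    by rewrite le_eqVlt; apply/orP; left; apply/eqP; congr (`|_|); ring.
  by apply: lerD; rewrite ?ler_wpM2l ?ler_wpM2r// kpow_bound.
under eq_bigr do rewrite big_split/=.
rewrite big_split/= -[m.+2]addn1 natrD.
rewrite (_ : _ * D = c * C ^+ m * D + c * (m.+1%:R * C ^+ m * D)); last by ring.
apply: lerD.
  by under eq_bigr do rewrite -mulr_suml; rewrite -mulr_suml mulrC.
under eq_bigr do rewrite -mulr_sumr.
by rewrite -mulr_sumr ler_wpM2l// exchange_big/= kpow_l1_dist.
Qed.

End comparison.
End kernel_powers.

(** * Power sums of eigenvalues of symmetric matrices *)

Section symmetric_spectrum.
Import complex.

Lemma ktrace_mx (R : realFieldType) n (A : 'M[R]_n) m :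
  ktrace (fun i j => A i j) m = \tr (iter m (mulmx A) 1%:M).
Proof.
apply: eq_bigr => i _.
suff : forall i j, kpow (fun i j => A i j) m i j = iter m (mulmx A) 1%:M i j.
  by [].
elim: m => [|m IH] {}i j /=; first by rewrite mxE.
by rewrite mxE; apply: eq_bigr => k _; rewrite IH.
Qed.

(** Powers of a diagonalized matrix; they are iterated products because square
matrices of arbitrary size, including 0, do not form a nontrivial ring. *)
Lemma iter_mulmx_conj_diag (F : fieldType) n (Q B : 'M[F]_n) (D : 'rV[F]_n) m :
  Q \in unitmx -> B = invmx Q *m diag_mx D *m Q ->
  iter m (mulmx B) 1%:M = invmx Q *m diag_mx (\row_i D 0 i ^+ m) *m Q.
Proof.
move=> Qu BE; elim: m => [|m IH] /=.
  rewrite (_ : \row_i _ = const_mx 1).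
    by rewrite diag_const_mx mulmx1 mulVmx.
  by apply/rowP => i; rewrite !mxE expr0.
rewrite IH BE -!mulmxA (mulmxA Q) mulmxV// mul1mx.
rewrite [in LHS](mulmxA (diag_mx D)) mulmx_diag; congr (_ *m (diag_mx _ *m _)).
by apply/rowP => i; rewrite !mxE exprS.
Qed.

(** The spectral theorem over the complex numbers gives the trace of the power in
terms of the diagonal entries, and unique factorization of the characteristic
polynomial identifies these entries with the spectrum. *)
Lemma spectrum_power_sum (R : realType) n (A : 'M[R]_n) m : A^T = A ->
  \sum_(x <- spectrum A) x ^+ m = ktrace (fun i j => A i j) m.
Proof.
move=> symA; have [_ cA] := spectrumP symA.
pose C : numClosedFieldType := complex.complex R.
pose toC : {rmorphism R -> C} := complex.real_complex_def (Phant R).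
pose B : 'M[C]_n := map_mx toC A.
have toC_real x : toC x \is Num.real by apply/complex.complex_realP; exists x.
have Bh : B \is hermsymmx.
  apply/is_hermitianmxP; rewrite expr0 scale1r; apply/matrixP => i j.
  by rewrite !mxE conj_Creal// -[in RHS]symA mxE.
have /orthomx_spectralP BE := hermitian_normalmx Bh.
set D := spectral_diag B in BE.
set Q := spectralmx B in BE.
have Qu : Q \in unitmx by exact: spectral_unit.
clearbody D Q.
have cB : char_poly B = \prod_(i < n) ('X - (D 0 i)%:P).
  transitivity (char_poly (diag_mx D)); last first.
    rewrite char_poly_trig; last exact/diag_mx_is_trig.
    by apply: eq_bigr => i _; rewrite mxE eqxx mulr1n.
  rewrite /char_poly /char_poly_mx BE.
  have -> : ('X%:M - map_mx polyC (invmx Q *m diag_mx D *m Q)) =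
      map_mx polyC (invmx Q) *m ('X%:M - map_mx polyC (diag_mx D))
        *m map_mx polyC Q.
    have QVQ : map_mx polyC (invmx Q) *m map_mx polyC Q = 1%:M.
      by rewrite -map_mxM mulVmx// map_mx1.
    rewrite mulmxBr mulmxBl !map_mxM; congr (_ - _).
    by rewrite scalar_mxC -mulmxA QVQ mulmx1.
  rewrite !det_mulmx mulrC mulrA -det_mulmx -map_mxM mulmxV// map_mx1 det1.
  by rewrite mul1r.
have perm : perm_eq [seq toC x | x <- spectrum A] [seq D 0 i | i <- index_enum 'I_n].
  apply: prod_XsubC_eq; rewrite !big_map -cB.
  rewrite -map_char_poly cA rmorph_prod/=; apply: eq_bigr => x _.
  by rewrite rmorphB /= map_polyX map_polyC.
apply: (fmorph_inj toC); rewrite ktrace_mx rmorph_sum/=.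
transitivity (\sum_(x <- [seq toC x | x <- spectrum A]) x ^+ m).
  by rewrite big_map; apply: eq_bigr => x _; rewrite rmorphXn.
rewrite (perm_big _ perm)/= big_map -(trace_map_mx toC).
have -> : map_mx toC (iter m (mulmx A) 1%:M) = iter m (mulmx B) 1%:M.
  by elim: m => [|m IH]; rewrite /= ?map_mx1// map_mxM IH.
rewrite (iter_mulmx_conj_diag m Qu BE).
rewrite mxtrace_mulC mulmxA mulmxV// mul1mx mxtrace_diag.
by apply: eq_bigr => i _; rewrite mxE.
Qed.

Lemma size_spectrum (R : realType) n (A : 'M[R]_n) : A^T = A ->
  size (spectrum A) = n.
Proof.
move=> symA; have [_ cA] := spectrumP symA.
by apply/succn_inj; rewrite -(size_char_poly A) cA size_prod_XsubC.
Qed.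

Section normalization.
Variables (R : realType) (n : nat) (A : 'M[R]_n).

Definition row_sum i : R := \sum_j A i j.

Definition normalize_mx : 'M[R]_n :=
  diag_mx (\row_i (Num.sqrt (row_sum i))^-1) *m A *m
  diag_mx (\row_i (Num.sqrt (row_sum i))^-1).

Lemma normalize_mxE i j :
  normalize_mx i j = (Num.sqrt (row_sum i))^-1 * A i j / Num.sqrt (row_sum j).
Proof. by rewrite /normalize_mx mul_mx_diag mxE mul_diag_mx !mxE. Qed.

Hypotheses (symA : A^T = A) (d0 : forall i, 0 < row_sum i).

Lemma normalize_mx_sym : normalize_mx^T = normalize_mx.
Proof. by rewrite /normalize_mx !trmx_mul tr_diag_mx symA mulmxA. Qed.

Let sd0 i : Num.sqrt (row_sum i) != 0.
Proof. by rewrite sqrtr_eq0 -ltNge. Qed.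

Lemma normalize_mx_power_sum m :
  \sum_(x <- spectrum normalize_mx) x ^+ m =
  ktrace (fun i j => A i j / row_sum i) m.
Proof.
rewrite spectrum_power_sum ?normalize_mx_sym//.
rewrite -(@ktrace_conj R _ (fun i j => normalize_mx i j)
  (fun i => (Num.sqrt (row_sum i))^-1)); last by move=> i; rewrite invr_eq0.
apply: eq_ktrace => i j; rewrite normalize_mxE.
rewrite -[in RHS](sqr_sqrtr (ltW (d0 i))).
by field; rewrite !sd0.
Qed.

(** If the walk has eigenfunction [f], then the symmetric normalization has the
eigenvector with entries [sqrt (row_sum i) * f i]. *)
Lemma mem_spectrum_normalize (f : 'I_n -> R) (l : R) i0 : f i0 != 0 ->
  (forall i, \sum_j A i j * f j = l * (row_sum i * f i)) ->
  l \in spectrum normalize_mx.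
Proof.
move=> f0 Af; have [_ cA] := spectrumP normalize_mx_sym.
rewrite -root_prod_XsubC -cA -eigenvalue_root_char; apply/eigenvalueP.
exists (\row_i (Num.sqrt (row_sum i) * f i)); last first.
  apply/eqP => /rowP/(_ i0)/eqP; rewrite !mxE mulf_eq0 (negbTE (sd0 _)).
  by rewrite (negbTE f0).
apply/rowP => j; rewrite !mxE.
rewrite (eq_bigr (fun i => A j i * f i / Num.sqrt (row_sum j))); last first.
  move=> i _; have -> : A j i = A i j by rewrite -[in LHS]symA mxE.
  rewrite mxE normalize_mxE.
  move: (sd0 i) (sd0 j) => /=; move: (Num.sqrt _) (Num.sqrt _) (A i j) (f i).
  by move=> a b c e a0 b0; field; rewrite b0.
rewrite -mulr_suml Af -{1}(sqr_sqrtr (ltW (d0 j))).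
by field; rewrite sd0.
Qed.

End normalization.
End symmetric_spectrum.

(** * Polynomial approximation of Lipschitz functions *)

Section bernstein.
Variable R : realType.

(** The expectation of [g] at a binomial variable with [n] trials and success
probability [u]; conditioning on the first trial gives the recursion, which
avoids binomial coefficients altogether. *)
Fixpoint bernstein n (g : nat -> R) (u : {poly R}) : {poly R} :=
  if n is n'.+1
  then u * bernstein n' (fun k => g k.+1) u + (1 - u) * bernstein n' g u
  else (g 0)%:P.

Lemma bernsteinS n g (u : {poly R}) x :
  (bernstein n.+1 g u).[x] = u.[x] * (bernstein n (fun k => g k.+1) u).[x]
    + (1 - u.[x]) * (bernstein n g u).[x].
Proof. by rewrite /= !hornerE. Qed.

Lemma bernstein_le n g h (u : {poly R}) x : 0 <= u.[x] <= 1 ->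
  (forall k, (k <= n)%N -> g k <= h k) ->
  (bernstein n g u).[x] <= (bernstein n h u).[x].
Proof.
move=> /andP[u0 u1]; elim: n g h => [|n IH] g h gh.
  by rewrite /= !hornerC gh.
rewrite !bernsteinS; apply: lerD; apply: ler_wpM2l; rewrite ?subr_ge0//.
  by apply: IH => k kn; exact: gh.
by apply: IH => k kn; apply: gh; exact: leqW.
Qed.

(** The variance of the binomial distribution, in the affine form in which the
recursion preserves it. *)
Lemma bernstein_quadratic n (a b c : R) (u : {poly R}) x :
  (bernstein n (fun k => a + b * (k%:R - c) ^+ 2) u).[x] =
  a + b * (n%:R * (u.[x] * (1 - u.[x])) + (n%:R * u.[x] - c) ^+ 2).
Proof.
elim: n c => [|n IH] c.
  rewrite /= hornerC !mul0r !add0r; ring.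
rewrite bernsteinS IH.
have -> : (fun k : nat => a + b * (k.+1%:R - c) ^+ 2) =
    (fun k => a + b * (k%:R - (c - 1)) ^+ 2).
  by apply/funext => k; rewrite -natr1; ring.
by rewrite IH -natr1; ring.
Qed.

(** Bernstein's proof: by the Lipschitz condition the error at [x] is at most the
mean of the distance from [k / n] to the rescaled point, and [`|t|] is at most
[h + t ^+ 2 / h], whose mean is controlled by the variance. *)
Lemma lipschitz_weierstrass (B K : R) (f : R -> R) : 0 < B -> 0 <= K ->
  (forall x y, `|x| <= B -> `|y| <= B -> `|f x - f y| <= K * `|x - y|) ->
  forall e : R, 0 < e -> exists q : {poly R},
  forall x, `|x| <= B -> `|f x - q.[x]| <= e.
Proof.
move=> B0 K0 lipf e e0.
pose c : R := 2 * B * K.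
(* With this h, both c * h and the variance term are at most e / 2. *)
pose h : R := e / (2 * (c + 1)).
have c0 : 0 <= c by rewrite !mulr_ge0// ltW.
have c1 : 0 < c + 1 by rewrite ltr_wpDl.
have h0 : 0 < h by rewrite divr_gt0// mulr_gt0.
have hE : h = e / (2 * (c + 1)) by [].
clearbody h.
pose n := (Num.truncn (h ^- 2)).+1.
have n0 : 0 < n%:R :> R by rewrite ltr0n.
have hn : (n%:R * h ^+ 2)^-1 <= 1.
  rewrite invf_le1 ?mulr_gt0 ?exprn_gt0//.
  by rewrite -ler_pdivrMr ?exprn_gt0// mul1r ltW// truncnS_gt.
pose u : {poly R} := (2 * B)^-1 *: 'X + (2^-1)%:P.
have uE x : u.[x] = (2 * B)^-1 * x + 2^-1 by rewrite /u !hornerE.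
pose g (k : nat) := f (2 * B * (k%:R / n%:R) - B).
have fg x : `|x| <= B -> forall k, (k <= n)%N ->
    `|f x - g k| <= c * h + (c / (h * n%:R ^+ 2)) * (k%:R - n%:R * u.[x]) ^+ 2.
  move=> xB k kn.
  pose v : R := k%:R / n%:R.
  have v0 : 0 <= v by exact: divr_ge0.
  have v1 : v <= 1 by rewrite ler_pdivrMr// mul1r ler_nat.
  have /(_ xB) := lipf x (2 * B * v - B).
  have -> : `|2 * B * v - B| <= B by rewrite ler_norml; nra.
  move=> /(_ isT) /le_trans; apply.
  set t := k%:R - n%:R * u.[x].
  have -> : x - (2 * B * v - B) = - (2 * B / n%:R * t).
    by rewrite /v /t uE; field; rewrite !gt_eqF.
  have tle : `|t| / n%:R <= h + (t / n%:R) ^+ 2 / h.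
    rewrite -{1}(gtr0_norm n0) -normf_div.
    have [th|/ltW th] := leP `|t / n%:R| h.
      by rewrite ler_wpDr// divr_ge0 ?sqr_ge0// ltW.
    rewrite ler_wpDl ?(ltW h0)// ler_pdivlMr// -[in leRHS]real_normK ?num_real//.
    by rewrite expr2 ler_wpM2l.
  rewrite normrN normrM (@gtr0_norm _ (2 * B / n%:R)) ?divr_gt0 ?mulr_gt0//.
  have -> : K * (2 * B / n%:R * `|t|) = c * (`|t| / n%:R) by rewrite /c; ring.
  apply: le_trans (ler_wpM2l c0 tle) _.
  rewrite le_eqVlt; apply/orP; left; apply/eqP.
  by field; rewrite !gt_eqF.
exists (bernstein n g u); move=> x xB.
have ux : 0 <= u.[x] <= 1.
  move: xB; rewrite ler_norml => /andP[x1 x2].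
  have -> : u.[x] = (x + B) / (2 * B) by rewrite uE; field; rewrite gt_eqF.
  have BB : 0 < 2 * B by rewrite mulr_gt0.
  apply/andP; split; first by apply: divr_ge0; lra.
  by rewrite ler_pdivrMr//; lra.
set a := c * h in fg *; set b := c / (h * n%:R ^+ 2) in fg *.
have b0 : 0 <= b by rewrite /b divr_ge0// mulr_ge0 ?sqr_ge0// ltW.
have bd : a + b * (n%:R * (u.[x] * (1 - u.[x])) +
    (n%:R * u.[x] - n%:R * u.[x]) ^+ 2) <= e.
  rewrite subrr expr0n/= addr0.
  have ux1 : u.[x] * (1 - u.[x]) <= 1 by nra.
  apply: le_trans (_ : a + b * n%:R <= _).
    by rewrite lerD2l ler_wpM2l// ler_piMr// ltW.
  have -> : b * n%:R = c * h * (n%:R * h ^+ 2)^-1.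
    by rewrite /b; field; rewrite !gt_eqF.
  apply: le_trans (_ : c * h + c * h <= _).
    by rewrite lerD2l ler_piMr// mulr_ge0// ltW.
  rewrite -mulr2n -mulr_natl hE.
  rewrite (_ : 2 * (c * (e / (2 * (c + 1)))) = e * (c / (c + 1))); last first.
    by field; rewrite gt_eqF.
  by apply: ler_piMr; [exact: ltW | rewrite ler_pdivrMr// mul1r; lra].
have lin s : (bernstein n (fun k => f x + s * (a + b * (k%:R - n%:R * u.[x]) ^+ 2)) u).[x]
    = f x + s * (a + b * (n%:R * (u.[x] * (1 - u.[x])) +
    (n%:R * u.[x] - n%:R * u.[x]) ^+ 2)).
  have -> : (fun k : nat => f x + s * (a + b * (k%:R - n%:R * u.[x]) ^+ 2)) =
      (fun k => (f x + s * a) + (s * b) * (k%:R - n%:R * u.[x]) ^+ 2).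
    by apply/funext => k; ring.
  by rewrite bernstein_quadratic; ring.
rewrite distrC ler_distl; apply/andP; split.
  apply: le_trans (_ : (bernstein n (fun k => f x + -1 *
     (a + b * (k%:R - n%:R * u.[x]) ^+ 2)) u).[x] <= _).
    by rewrite lin; lra.
  by apply: bernstein_le => // k kn; move: (fg x xB k kn); rewrite ler_distlC; lra.
apply: le_trans (_ : _ <= (bernstein n (fun k => f x + 1 *
     (a + b * (k%:R - n%:R * u.[x]) ^+ 2)) u).[x]) _.
  by apply: bernstein_le => // k kn; move: (fg x xB k kn); rewrite ler_distlC; lra.
by rewrite lin; lra.
Qed.

End bernstein.

(** * Sums over spectra with converging power sums *)

Section moments.
Variable R : realType.
Implicit Types (tau : nat -> R) (s t : nat -> seq R) (c r e l : R).

(** Power sums start at order 2: that of order 0 is the number of eigenvalues, and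
that of order 1 is not determined by the eigenvalues away from 0, because the
many small ones contribute to it in the limit. *)
Definition has_moments tau s :=
  forall m, (fun n => \sum_(x <- s n) x ^+ m.+2) @ \oo --> tau m.

Lemma has_moments_horner tau s (q : {poly R}) : has_moments tau s ->
  (fun n => \sum_(x <- s n) x ^+ 2 * q.[x]) @ \oo -->
  \sum_(j < size q) q`_j * tau j.
Proof.
move=> st; have -> : (fun n => \sum_(x <- s n) x ^+ 2 * q.[x]) =
    (fun n => \sum_(j < size q) q`_j * \sum_(x <- s n) x ^+ j.+2).
  apply/funext => n; under [RHS]eq_bigr do rewrite mulr_sumr.
  rewrite exchange_big/=; apply: eq_bigr => x _.
  rewrite horner_coef mulr_sumr; apply: eq_bigr => j _.
  by rewrite mulrCA -exprD add2n.
apply: (cvg_big (op := +%R)); first exact: add_continuous.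
by move=> j _; apply: cvgMl_tmp; exact: st.
Qed.

Lemma has_moments_bounded tau s : has_moments tau s ->
  \forall n \near \oo, \sum_(x <- s n) x ^+ 2 <= `|tau 0%N| + 2 /\
    forall x, x \in s n -> `|x| <= `|tau 0%N| + 2.
Proof.
move=> /(_ 0%N)/cvgrPdist_le/(_ _ ltr01) near1.
near=> n.
have sT : \sum_(x <- s n) x ^+ 2 <= `|tau 0%N| + 1.
  have : `|tau 0%N - \sum_(x <- s n) x ^+ 2| <= 1 by near: n.
  by rewrite ler_norml => /andP[? ?]; have := ler_norm (tau 0%N); lra.
split=> [|x xs]; first by lra.
have x2 : x ^+ 2 <= `|tau 0%N| + 1.
  apply: le_trans sT; rewrite (big_rem x)//= lerDl sumr_ge0// => y _.
  exact: sqr_ge0.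
rewrite leNgt; apply/negP => Bx; move: x2; rewrite leNgt => /negP; apply.
rewrite -(real_normK (num_real x)).
by have := normr_ge0 (tau 0%N); move: Bx; nra.
Unshelve. all: end_near. Qed.

(** The limit [Q] is the same for all sequences with power sums [tau], which is
what makes different sequences comparable. The reason: [f x = x ^+ 2 * g x] with
[g] Lipschitz, [g] is uniformly close to a polynomial on the bounded set that
eventually contains the spectra, and the error is multiplied by sums of squares,
which are bounded. *)
Lemma lipschitz_moment_approx tau (f : R -> R) (h K : R) : 0 < h -> 0 <= K ->
  (forall x y, `|f x - f y| <= K * `|x - y|) ->
  (forall x, `|x| <= h -> f x = 0) ->
  forall e : R, 0 < e -> exists Q, forall s, has_moments tau s ->
  \forall n \near \oo, `|\sum_(x <- s n) f x - Q| <= e.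
Proof.
move=> h0 K0 lipf f0 e e0.
(* Eventually all elements of s n are in [-B, B], whatever the sequence s. *)
pose B : R := `|tau 0%N| + 2.
have B0 : 0 < B by rewrite ltr_wpDl.
pose M (x : R) := Num.max `|x| h.
have Mh x : h <= M x by rewrite le_max lexx orbT.
have M0 x : 0 < M x by exact: lt_le_trans (Mh x).
have lipM x y : `|M x - M y| <= `|x - y|.
  have := ler_dist_dist x y; rewrite /M !ler_norml => /andP[].
  by case: (ltP `|x| h); case: (ltP `|y| h) => *; apply/andP; split; lra.
have fB x : `|x| <= B -> `|f x| <= K * B.
  move=> xB; have := lipf x 0; rewrite (f0 0) ?normr0 ?(ltW h0)// !subr0.
  by move=> /le_trans; apply; rewrite ler_wpM2l.
(* Dividing by the maximum of |x| and h keeps the quotient Lipschitz at 0. *)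
pose g x := f x / M x ^+ 2.
have sumg x : f x = x ^+ 2 * g x.
  rewrite /g /M; case: (ltP `|x| h) => xh.
    by rewrite f0 ?mul0r ?mulr0// ltW.
  rewrite real_normK ?num_real// mulrC divfK// sqrf_eq0 -normr_gt0.
  exact: lt_le_trans xh.
have lipg x y : `|x| <= B -> `|y| <= B ->
    `|g x - g y| <= (K / h ^+ 2 + K * B * (2 / h ^+ 3)) * `|x - y|.
  move=> xB yB.
  have -> : g x - g y = (f x - f y) * (M x ^- 2) +
      f y * ((M y - M x) * ((M x ^+ 2)^-1 * (M y)^-1 + (M x)^-1 * (M y ^+ 2)^-1)).
    by rewrite /g; field; rewrite !gt_eqF.
  have iM z : 0 <= (M z)^-1 <= h^-1.
    by rewrite invr_ge0 (ltW (M0 z))/= lef_pV2 ?posrE.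
  have iM2 z : 0 <= (M z ^+ 2)^-1 <= (h ^+ 2)^-1.
    rewrite invr_ge0 exprn_ge0 ?(ltW (M0 z))//= lef_pV2 ?posrE ?exprn_gt0//.
    by rewrite ler_pXn2r ?nnegrE ?(ltW (M0 z)) ?(ltW h0).
  rewrite [leRHS]mulrDl; apply: le_trans (ler_normD _ _) _; apply: lerD.
    rewrite normrM [leRHS]mulrAC; apply: ler_pM => //.
    by have /andP[a b] := iM2 x; rewrite ger0_norm.
  rewrite normrM -[leRHS]mulrA; apply: ler_pM => //; first exact: fB.
  rewrite normrM [leRHS]mulrC; apply: ler_pM => //; first by rewrite distrC lipM.
  have /andP[a b] := iM2 x; have /andP[a' b'] := iM y.
  have /andP[c d] := iM2 y; have /andP[c' d'] := iM x.
  rewrite ger0_norm ?addr_ge0 ?mulr_ge0//.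
  have -> : 2 / h ^+ 3 = (h ^+ 2)^-1 * h^-1 + h^-1 * (h ^+ 2)^-1.
    by field; rewrite gt_eqF.
  by apply: lerD; apply: ler_pM.
have Kg0 : 0 <= K / h ^+ 2 + K * B * (2 / h ^+ 3).
  rewrite addr_ge0 ?mulr_ge0 ?invr_ge0 ?exprn_ge0 ?(ltW h0)//; exact: ltW.
have e'0 : 0 < e / 2 / B by rewrite !divr_gt0.
have [q qg] := lipschitz_weierstrass B0 Kg0 lipg e'0.
exists (\sum_(j < size q) q`_j * tau j) => s st.
have e20 : 0 < e / 2 by rewrite divr_gt0.
have /cvgrPdist_le/(_ _ e20) near1 := has_moments_horner (q := q) st.
have near2 := has_moments_bounded st.
near=> n.
have [sT sB] : \sum_(x <- s n) x ^+ 2 <= B /\ forall x, x \in s n -> `|x| <= B.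
  by near: n.
have -> : \sum_(x <- s n) f x - \sum_(j < size q) q`_j * tau j =
   \sum_(x <- s n) x ^+ 2 * (g x - q.[x]) -
   (\sum_(j < size q) q`_j * tau j - \sum_(x <- s n) x ^+ 2 * q.[x]).
  rewrite opprB addrA; congr (_ - _); rewrite -big_split/=.
  by apply: eq_bigr => x _; rewrite sumg; ring.
rewrite (splitr e); apply: le_trans (ler_normB _ _) _; apply: lerD; last first.
  by near: n.
apply: le_trans (ler_norm_sum _ _ _) _.
apply: le_trans (_ : \sum_(x <- s n) x ^+ 2 * (e / 2 / B) <= _).
  rewrite big_seq [leRHS]big_seq; apply: ler_sum => x xs.
  by rewrite normrM ger0_norm ?sqr_ge0// ler_wpM2l ?sqr_ge0// qg ?sB.
rewrite -mulr_suml mulrC -ler_pdivlMl// invf_div divfK//.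
by rewrite gt_eqF.
Unshelve. all: end_near. Qed.

(** Equal to 1 on the interval of centre [c] and radius [r - e], to 0 outside the
interval of radius [r], and affine in between. *)
Definition plateau (c r e x : R) : R := Num.max 0 (Num.min 1 ((r - `|x - c|) / e)).

Lemma plateau_ge0 c r e x : 0 <= plateau c r e x.
Proof. by rewrite le_max lexx. Qed.

Lemma plateau_le1 c r e x : plateau c r e x <= 1.
Proof. by rewrite ge_max ler01 ge_min lexx. Qed.

Lemma plateau_out c r e x : 0 < e -> r <= `|x - c| -> plateau c r e x = 0.
Proof.
move=> e0 rx; apply/max_idPl; rewrite ge_min; apply/orP; right.
by rewrite ler_pdivrMr// mul0r subr_le0.
Qed.

Lemma plateau_in c r e x : 0 < e -> `|x - c| <= r - e -> plateau c r e x = 1.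
Proof.
move=> e0 rx; rewrite /plateau min_l ?max_r//.
by rewrite ler_pdivlMr// mul1r; lra.
Qed.

Lemma plateau_lipschitz c r e x y : 0 < e ->
  `|plateau c r e x - plateau c r e y| <= e^-1 * `|x - y|.
Proof.
move=> e0; set a := (r - `|x - c|) / e; set b := (r - `|y - c|) / e.
apply: le_trans (_ : `|a - b| <= _).
  rewrite /plateau -/a -/b.
  have /andP[] : - `|a - b| <= a - b <= `|a - b| by rewrite -ler_norml.
  rewrite ler_norml; move: `|a - b| => d; have := normr_ge0 (a - b).
  case: (ltP 1 a); case: (ltP 1 b); rewrite /Num.max/=;
  repeat (case: ifPn; rewrite -?leNgt); move=> *; apply/andP; split; lra.
rewrite /a /b -mulrBl normrM mulrC ger0_norm ?invr_ge0 ?(ltW e0)//.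
rewrite ler_wpM2l ?invr_ge0 ?(ltW e0)//.
have -> : r - `|x - c| - (r - `|y - c|) = `|y - c| - `|x - c| by ring.
apply: le_trans (ler_dist_dist _ _) _.
by rewrite opprB addrA subrK distrC.
Qed.

Lemma plateau_moment_approx tau c r e : 0 < e -> r < `|c| ->
  forall d : R, 0 < d -> exists Q, forall s, has_moments tau s ->
  \forall n \near \oo, `|\sum_(x <- s n) plateau c r e x - Q| <= d.
Proof.
move=> e0 rc; apply: (@lipschitz_moment_approx _ _ (`|c| - r) e^-1).
- by rewrite subr_gt0.
- by rewrite invr_ge0 ltW.
- by move=> x y; exact: plateau_lipschitz.
- move=> x xc; apply: plateau_out => //.
  have := lerB_dist c x; rewrite distrC; lra.
Qed.

Lemma plateau_sum_cvg tau s c r e : 0 < e -> r < `|c| -> has_moments tau s ->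
  cvgn (fun n => \sum_(x <- s n) plateau c r e x).
Proof.
move=> e0 rc st; apply/cauchy_cvgP; apply: cauchy_exP => d d0.
have [Q /(_ _ st) sQ] := plateau_moment_approx tau e0 rc (divr_gt0 d0 (ltr0n _ 2)).
exists Q; near=> n; rewrite /= /ball/= distrC.
apply: le_lt_trans (_ : d / 2 < d); last by lra.
by near: n.
Unshelve. all: end_near. Qed.

Lemma plateau_sum_transfer tau s t c r e l : 0 < e -> r < `|c| ->
  has_moments tau s -> has_moments tau t ->
  (fun n => \sum_(x <- t n) plateau c r e x) @ \oo --> l ->
  (fun n => \sum_(x <- s n) plateau c r e x) @ \oo --> l.
Proof.
move=> e0 rc st tt tl; apply/cvgrPdist_le => d d0.
have d30 : 0 < d / 3 by rewrite divr_gt0.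
have [Q tQ] := plateau_moment_approx tau e0 rc d30.
have near1 := tQ _ st; have near2 := tQ _ tt.
have /cvgrPdist_le/(_ _ d30) near3 := tl.
have lQ : `|l - Q| <= d / 3 + d / 3.
  near \oo => k.
  rewrite -(subrK (\sum_(x <- t k) plateau c r e x) l) -addrA.
  apply: le_trans (ler_normD _ _) _; apply: lerD; near: k; done.
near=> n; rewrite -(subrK Q l) -addrA.
have -> : d = (d / 3 + d / 3) + d / 3 by field.
apply: le_trans (ler_normD _ _) _; apply: lerD => //.
by rewrite distrC; near: n.
Unshelve. all: end_near. Qed.

End moments.

(** * Accumulation points of a sequence of spectra *)

Section counting.
Variable R : realType.
Implicit Types (tau : nat -> R) (s t : nat -> seq R) (c r e l : R).

Lemma plateau_neq0 c r e (x : R) : 0 < e -> plateau c r e x != 0 -> `|x - c| < r.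
Proof.
by move=> e0; apply: contraR; rewrite -leNgt => rx; rewrite plateau_out.
Qed.

(** The sums of a plateau function over [t] vanish, so those over [s] tend to 0,
while every element on the plateau contributes 1. *)
Lemma gap_transfer tau s t c r e : 0 < e -> r < `|c| ->
  has_moments tau s -> has_moments tau t ->
  (\forall n \near \oo, forall x, x \in t n -> r <= `|x - c|) ->
  \forall n \near \oo, forall x, x \in s n -> r - e < `|x - c|.
Proof.
move=> e0 rc st tt gap.
have t0 : (fun n => \sum_(x <- t n) plateau c r e x) @ \oo --> (0 : R).
  apply: cvg_near_cst; near=> n.
  rewrite big_seq big1// => x xt; apply: plateau_out => //.
  by move: x xt; near: n.
have /cvgrPdist_lt/(_ _ ltr01) near1 := plateau_sum_transfer e0 rc st tt t0.
near=> n => x xs; rewrite ltNge; apply/negP => xc.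
have : `|0 - \sum_(x <- s n) plateau c r e x| < 1 by near: n.
rewrite sub0r normrN ger0_norm; last by apply: sumr_ge0 => *; exact: plateau_ge0.
apply/negP; rewrite -leNgt (big_rem x)//= plateau_in// lerDl.
by apply: sumr_ge0 => *; exact: plateau_ge0.
Unshelve. all: end_near. Qed.

(** Near an accumulation point [t n] has elements for infinitely many [n]; by
[accumulation_near] it then has some for all large [n]. The point 0 is added
since eigenvalues of the graphs do gather there. *)
Definition accumulation t : set R :=
  [set c | c = 0 \/ forall r, 0 < r ->
     ~ \forall n \near \oo, forall x, x \in t n -> r <= `|x - c|].

Lemma not_accumulation tau s t c : has_moments tau s -> has_moments tau t ->
  ~ accumulation t c ->
  exists2 r, 0 < r & \forall n \near \oo, forall x, x \in s n -> r < `|x - c|.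
Proof.
move=> st tt; rewrite /accumulation/= not_orP => -[/eqP c0].
move=> /existsNP[r /not_implyP[r0 /contrapT near1]].
have c0' : 0 < `|c| by rewrite normr_gt0.
pose r' := Num.min r (`|c| / 2).
have r'0 : 0 < r' by rewrite lt_min r0 divr_gt0.
exists (r' - r' / 2); first by lra.
apply: (gap_transfer (tau := tau) (t := t)) => //; first by lra.
  by rewrite gt_min; apply/orP; right; lra.
near=> n => x xt; rewrite ge_min; apply/orP; left.
by move: x xt; near: n.
Unshelve. all: end_near. Qed.

(** The sum of a plateau function around [c] converges, and it is at least 1
infinitely often, so its limit is at least 1. *)
Lemma accumulation_near tau t c r : has_moments tau t -> accumulation t c ->
  c != 0 -> 0 < r ->
  \forall n \near \oo, exists2 x, x \in t n & `|x - c| < r.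
Proof.
move=> tt [->|]; first by rewrite eqxx.
move=> acc c0 r0.
have c0' : 0 < `|c| by rewrite normr_gt0.
pose r' := Num.min r (`|c| / 2).
have r'0 : 0 < r' by rewrite lt_min r0 divr_gt0.
have r'c : r' < `|c| by rewrite gt_min; apply/orP; right; lra.
have r'20 : 0 < r' / 2 by lra.
have /cvg_ex[/= l tl] := plateau_sum_cvg r'20 r'c tt.
have l1 : 1 <= l.
  rewrite leNgt; apply/negP => l1; apply: (acc _ r'20).
  have /cvgrPdist_lt/(_ (1 - l)) := tl; rewrite subr_gt0 => /(_ l1) near1.
  near=> n => x xt; rewrite leNgt; apply/negP => xc.
  have : `|l - \sum_(x <- t n) plateau c r' (r' / 2) x| < 1 - l by near: n.
  rewrite ltr_norml => /andP[+ _]; rewrite (big_rem x)//= plateau_in//; last by lra.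
  have : 0 <= \sum_(y <- rem x (t n)) plateau c r' (r' / 2) y.
    by apply: sumr_ge0 => *; exact: plateau_ge0.
  by lra.
have /cvgrPdist_lt/(_ _ ltr01) near1 := tl.
near=> n.
have h : `|l - \sum_(x <- t n) plateau c r' (r' / 2) x| < 1 by near: n.
apply: contrapT => nex; move: h; rewrite big_seq big1 ?subr0.
  by rewrite ger0_norm; lra.
move=> x xt; apply: contrapT => /eqP /(plateau_neq0 r'20) xc; apply: nex; exists x => //.
by apply: lt_le_trans xc _; rewrite ge_min lexx.
Unshelve. all: end_near. Qed.

Lemma uniq_separated (u : seq R) : uniq u ->
  exists2 r, 0 < r & forall x y, x \in u -> y \in u -> x != y -> 2 * r <= `|x - y|.
Proof.
elim: u => [_|a u IH /= /andP[au /IH[r r0 ru]]]; first by exists 1.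
have [r' r'0 r'u] : exists2 r', 0 < r' & forall y, y \in u -> 2 * r' <= `|a - y|.
  elim: u au {IH ru} => [_|b u IH]; first by exists 1.
  rewrite inE negb_or => /andP[ab /IH[r' r'0 r'u]].
  exists (Num.min r' (`|a - b| / 2)).
    by rewrite lt_min r'0 divr_gt0// normr_gt0 subr_eq0.
  move=> y; rewrite inE => /orP[/eqP->|/r'u yr'].
    have : Num.min r' (`|a - b| / 2) <= `|a - b| / 2 by rewrite ge_min lexx orbT.
    by lra.
  have : Num.min r' (`|a - b| / 2) <= r' by rewrite ge_min lexx.
  by lra.
have m1 : Num.min r r' <= r by rewrite ge_min lexx.
have m2 : Num.min r r' <= r' by rewrite ge_min lexx orbT.
exists (Num.min r r'); first by rewrite lt_min r0.
move=> x y; rewrite !inE => /orP[/eqP->|xu] /orP[/eqP->|yu]; rewrite ?eqxx//.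
- by move=> _; have := r'u _ yu; lra.
- by move=> _; rewrite distrC; have := r'u _ xu; lra.
- by move=> xy; have := ru _ _ xu yu xy; lra.
Qed.

(** Distinct accumulation points outside of [(- e, e)] give distinct elements of
[t n] of absolute value at least [e / 2], and the sum of squares bounds their
number. *)
Lemma accumulation_finite tau t e : has_moments tau t -> 0 < e ->
  finite_set [set c | accumulation t c /\ e <= `|c|].
Proof.
move=> tt e0; apply: contrapT => /infinite_set_fset inf.
have tC := has_moments_bounded tt; set C := `|tau 0%N| + 2 in tC.
have C0 : 0 < C by rewrite ltr_wpDl.
(* At most 4 C / e^2 elements can have absolute value at least e / 2. *)
pose N := (Num.truncn (4 * C / e ^+ 2)).+1.
have [A Asub AN] := inf N.
have [r r0 rA] := uniq_separated (fset_uniq A).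
pose r' := Num.min r (e / 2).
have r'0 : 0 < r' by rewrite lt_min r0 divr_gt0.
have r'r : r' <= r by rewrite ge_min lexx.
have r'e : r' <= e / 2 by rewrite ge_min lexx orbT.
have acc c : c \in A -> accumulation t c /\ e <= `|c| by move=> /Asub.
have near1 : \forall n \near \oo, forall c, c \in enum_fset A ->
    exists2 x, x \in t n & `|x - c| < r'.
  have : forall c, c \in enum_fset A -> accumulation t c /\ e <= `|c| by [].
  elim: (enum_fset A) => [|c B IH] h; first by apply: nearW.
  have [ac ec] := h c (mem_head _ _).
  have c0 : c != 0 by rewrite -normr_gt0 (lt_le_trans e0).
  have n1 := accumulation_near tt ac c0 r'0.
  have n2 := IH (fun x xB => h x (mem_behead (s := c :: B) xB)).
  near=> n => x; rewrite inE => /orP[/eqP ->|xB]; first by near: n.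
  by move: x xB; near: n.
near \oo => n.
have [sC _] : \sum_(x <- t n) x ^+ 2 <= C /\ forall x, x \in t n -> `|x| <= C.
  by near: n.
have hA : forall c, c \in enum_fset A -> exists2 x, x \in t n & `|x - c| < r'.
  by near: n.
have lb : (size (enum_fset A))%:R <=
    \sum_(c <- enum_fset A) \sum_(x <- t n) (`|x - c| < r')%R%:R :> R.
  rewrite -sum1_size natr_sum big_seq [leRHS]big_seq; apply: ler_sum => c cA.
  have [x xt xc] := hA c cA.
  by rewrite (big_rem x)//= xc lerDl sumr_ge0.
have ub : \sum_(c <- enum_fset A) \sum_(x <- t n) (`|x - c| < r')%R%:R <=
    4 / e ^+ 2 * \sum_(x <- t n) x ^+ 2 :> R.
  rewrite exchange_big/= mulr_sumr; apply: ler_sum => x _.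
  have [/hasP[c cA xc]|/hasPn h] := boolP (has (fun c => `|x - c| < r') (enum_fset A)).
    rewrite (big_rem c)//= xc big_seq big1 ?addr0.
      have [_ ec] := acc c cA.
      have xe : e / 2 <= `|x|.
        by have := lerB_dist c x; rewrite distrC; lra.
      rewrite mulrAC ler_pdivlMr ?exprn_gt0// mul1r.
      by rewrite -(real_normK (num_real x)); nra.
    move=> c' c'A; rewrite ltNge; have -> // : r' <= `|x - c'|.
    have ne : c' != c.
      by apply: contraTneq c'A => ->; rewrite mem_rem_uniqF// fset_uniq.
    have := rA _ _ (mem_rem c'A) cA ne.
    have := ler_normD (c' - x) (x - c); rewrite addrA subrK (distrC c' x).
    by lra.
  rewrite big_seq big1; last by move=> c cA; rewrite (negbTE (h c cA)).
  by rewrite mulr_ge0 ?sqr_ge0// divr_ge0 ?sqr_ge0.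
have : N%:R <= 4 * C / e ^+ 2.
  apply: le_trans (_ : (size (enum_fset A))%:R <= _); first by rewrite ler_nat.
  apply: le_trans (le_trans lb ub) _; rewrite [leLHS]mulrAC.
  have e2 : 0 <= e ^- 2 by apply: ltW; rewrite invr_gt0 exprn_gt0.
  by apply: ler_wpM2r => //; apply: ler_wpM2l.
by apply/negP; rewrite -ltNge truncnS_gt.
Unshelve. all: end_near. Qed.

End counting.

(** * Counting eigenvalues in intervals *)

Section interval_counts.
Variable R : realType.
Implicit Types (tau : nat -> R) (s t : nat -> seq R) (c r e l a b : R).

Lemma sum_plateau_count (u : seq R) c r e (I : set R) :
  {in u, forall x, plateau c r e x = (x \in I)%:R} ->
  \sum_(x <- u) plateau c r e x = (count (fun x => x \in I) u)%:R.
Proof.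
move=> h; rewrite big_seq (eq_bigr (fun x => (x \in I)%:R)); last first.
  by move=> x xu; rewrite h.
rewrite -big_seq -sum1_count [X in X%:R]big_mkcond/= natr_sum.
by apply: eq_bigr => x _; case: (x \in I).
Qed.

(** Since no element comes close to the end points, the count eventually equals
the sum of a plateau function. *)
Lemma count_cvg tau s t a b : has_moments tau s -> has_moments tau t ->
  0 < a -> a < b -> ~ accumulation t a -> ~ accumulation t b ->
  cvgn (fun n => (count (fun x => x \in `]a, b[%classic) (s n))%:R : R).
Proof.
move=> st tt a0 ab Sa Sb.
have [ra ra0 near1] := not_accumulation st tt Sa.
have [rb rb0 near2] := not_accumulation st tt Sb.
pose c := (a + b) / 2; pose r := (b - a) / 2; pose e := Num.min ra rb.
have e0 : 0 < e by rewrite lt_min ra0.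
have rc : r < `|c| by rewrite /r /c ger0_norm; lra.
have /cvg_ex[/= l sl] := plateau_sum_cvg e0 rc st.
apply/cvg_ex; exists l => /=; apply: cvg_trans sl; apply: near_eq_cvg.
near=> n.
have ga x : x \in s n -> ra < `|x - a| by move: x; near: n.
have gb x : x \in s n -> rb < `|x - b| by move: x; near: n.
apply: sum_plateau_count => x xs; have xa := ga x xs; have xb := gb x xs.
have ea : e <= ra by rewrite ge_min lexx.
have eb : e <= rb by rewrite ge_min lexx orbT.
have [xI|xI] := boolP (x \in _).
  move: xI; rewrite inE /= in_itv/= => /andP[ax xb'].
  move: xa xb; rewrite gtr0_norm ?subr_gt0// ltr0_norm ?subr_lt0// => xa xb.
  by rewrite plateau_in// ler_norml /r /c; apply/andP; split; lra.
rewrite plateau_out// /r /c leNgt ltr_norml; apply: contra xI => /andP[h1 h2].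
by rewrite inE/= in_itv/=; apply/andP; split; lra.
Unshelve. all: end_near. Qed.

(** The count is at least the sum of a plateau function, whose limit is at least
[m]; an integer above [m - 1] is at least [m]. *)
Lemma count_near_lower tau s t c (m : nat) (delta : R) :
  has_moments tau s -> has_moments tau t -> c != 0 -> 0 < delta ->
  (\forall n \near \oo, (m <= count_mem c (t n))%N) ->
  \forall n \near \oo,
    (m <= count (fun x => x \in (`]c - delta, c + delta[%classic)%R) (s n))%N.
Proof.
move=> st tt c0 delta0 tm.
have c0' : 0 < `|c| by rewrite normr_gt0.
pose r := Num.min delta (`|c| / 2).
have r0 : 0 < r by rewrite lt_min delta0 divr_gt0.
have rc : r < `|c| by rewrite gt_min; apply/orP; right; lra.
have rd : r <= delta by rewrite ge_min lexx.
have /cvg_ex[/= l tl] := plateau_sum_cvg r0 rc tt.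
have sl := plateau_sum_transfer r0 rc st tt tl.
have ml : m%:R <= l.
  apply: (cvgr_to_ge tl); near=> n.
  apply: le_trans (_ : (count_mem c (t n))%:R <= _).
    by rewrite ler_nat; near: n.
  rewrite -sum1_count big_mkcond/= natr_sum; apply: ler_sum => x _.
  case: eqP => [->|_]; last exact: plateau_ge0.
  by rewrite plateau_in// subrr normr0 subrr.
have /cvgrPdist_lt/(_ _ ltr01) near1 := sl.
near=> n.
have : `|l - \sum_(x <- s n) plateau c r r x| < 1 by near: n.
have : \sum_(x <- s n) plateau c r r x <=
    (count (fun x => x \in `]c - delta, c + delta[%classic) (s n))%:R.
  rewrite -sum1_count [X in X%:R]big_mkcond/= natr_sum; apply: ler_sum => x _.
  case: ifPn => [_|xI]; first exact: plateau_le1.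
  rewrite plateau_out// leNgt; apply: contra xI; rewrite ltr_norml => /andP[h1 h2].
  by rewrite inE/= in_itv/=; apply/andP; split; lra.
rewrite ltr_norml -ltnS -(ltr_nat R) -natr1 => h1 /andP[h2 h3].
by lra.
Unshelve. all: end_near. Qed.

(** Only boundedly many elements stay away from 0, by the bound on the sum of
squares. *)
Lemma count_pinfty tau s (A : set R) h : has_moments tau s ->
  (forall n, size (s n) = n) -> 0 < h -> (forall x, `|x| < h -> A x) ->
  (fun n => (count (fun x => x \in A) (s n))%:R%:E : \bar R) @ \oo --> +oo%E.
Proof.
move=> st szs h0 hA; have sC := has_moments_bounded st; set C := `|tau 0%N| + 2 in sC.
apply/cvgeyPge => B; near=> n.
have [sn _] : \sum_(x <- s n) x ^+ 2 <= C /\ forall x, x \in s n -> `|x| <= C.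
  by near: n.
have nA : (count (fun x => x \notin A) (s n))%:R <= C / h ^+ 2.
  rewrite ler_pdivlMr ?exprn_gt0//; apply: le_trans sn.
  rewrite -sum1_count [X in X%:R]big_mkcond/= natr_sum mulr_suml.
  apply: ler_sum => x _; case: ifPn => [xA|_]; last by rewrite mul0r sqr_ge0.
  rewrite mul1r -(real_normK (num_real x)) ler_pXn2r ?nnegrE ?(ltW h0)//.
  by rewrite leNgt; apply: contra xA => /hA; rewrite inE.
rewrite lee_fin.
have : (count (fun x => x \in A) (s n))%:R + (count (fun x => x \notin A) (s n))%:R
    = n%:R :> R.
  by rewrite -natrD; congr (_%:R); rewrite -[RHS](szs n); exact: count_predC.
have : B + C / h ^+ 2 <= n%:R by near: n; exact: nbhs_infty_ger.
by lra.
Unshelve. all: end_near. Qed.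

(** The four inequalities say that [x] avoids the four gaps between the clusters
at [-rho, rho], 1/2 and 1 inside [-B, B]. *)
Lemma gaps_classify (x rho e B : R) : 0 < rho -> e <= 3 / 10 - rho ->
  `|x| <= B -> (1 / 2 - rho) / 2 - e < `|x - (1 / 2 + rho) / 2| ->
  1 / 4 - e < `|x - 3 / 4| ->
  (B + 1) / 2 - e < `|x - (1 + (B + 1) / 2)| ->
  (B + 1) / 2 - e < `|x - (- rho - (B + 1) / 2)| -> e <= 1 / 16 ->
  [\/ `|x| <= 3 / 10, `|x - 1 / 2| < e | `|x - 1| < e].
Proof.
move=> rho0 er; rewrite ler_norml => /andP[xB xB'].
rewrite !ltr_normr => /orP h1 /orP h2 /orP h3 /orP h4 e16.
have [x1|x1] := ltP x (1 / 2 - e).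
  apply: Or31; rewrite ler_norml.
  by case: h4 => ?; case: h1 => ?; apply/andP; split; lra.
have [x2|x2] := ltP (1 - e) x.
  by apply: Or33; rewrite ltr_norml; case: h3 => ?; apply/andP; split; lra.
apply: Or32; rewrite ltr_norml.
by case: h1 => ?; case: h2 => ?; apply/andP; split; lra.
Qed.

(** For large [n] the spectrum splits into a part in [-3/10, 3/10], a cluster at
1/2 and a cluster at 1, since gaps transfer. The clusters have [d] elements and
one element, because their sizes are sums of plateau functions. The only
element in the cluster at 1 is 1 itself, so that the end points of [I] near 1
do not matter, whereas those near 1/2 are excluded by the hypothesis on the
frontier. *)
Lemma count_half_eventually tau s t (d : nat) (rho : R) :
  has_moments tau s -> has_moments tau t -> 0 < rho -> rho < 3 / 10 ->
  (\forall n \near \oo, exists2 u : seq R,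
     perm_eq (t n) (1 :: nseq d 2^-1 ++ u) & {in u, forall x, `|x| <= rho}) ->
  (\forall n \near \oo, 1 \in s n) ->
  forall I : set R, I `<=` ~` `[- (3 / 10), 3 / 10]%classic ->
    ~ frontier I (1 / 2) ->
  \forall n \near \oo, count (fun x => x \in I) (s n) =
    ((1%R \in I) + d * ((1 / 2)%R \in I))%N.
Proof.
move=> st tt rho0 rho3 tu s1 I I3 fI.
have sB := has_moments_bounded st; set B := `|tau 0%N| + 2 in sB.
have B0 : 0 < B by rewrite ltr_wpDl.
clearbody B.
have [e1 e10 Ie1] : exists2 e1 : R, 0 < e1 & forall x : R, `|x - 1 / 2| < e1 ->
    (x \in I) = ((1 / 2)%R \in I).
  have nbhsI (J : set R) : ~ closure J (1 / 2) ->
      exists2 e1 : R, 0 < e1 & forall x : R, `|x - 1 / 2| < e1 -> ~ J x.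
    move=> /existsNP[U /not_implyP[/nbhs_ballP[e1 /= e10 e1U] nU]]; exists e1 => // x xe Jx; apply: nU.
    by exists x; split => //; apply: e1U; rewrite /ball/= distrC.
  have [/nbhsI|cI] := pselect (~ closure I (1 / 2)).
    move=> [e1 e10 h]; exists e1 => // x /h Ix.
    have I2 : ~ I (1 / 2) by apply: h; rewrite subrr normr0.
    by rewrite memNset// memNset.
  have /nbhsI[e1 e10 h] : ~ closure (~` I) (1 / 2).
    by move=> cnI; apply: fI; split => //; apply: contrapT.
  have {}h x : `|x - 1 / 2| < e1 -> I x by move=> /h; apply: contrapT.
  exists e1 => // x /h Ix; have I2 : I (1 / 2) by apply: h; rewrite subrr normr0.
  by rewrite !mem_set.
(* e-neighbourhoods of 1/2 and 1 are disjoint, and that of [-rho, rho] stays in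
   [-3/10, 3/10]. *)
pose e := Num.min e1 (Num.min (1 / 16) (3 / 10 - rho)).
have e0 : 0 < e by rewrite !lt_min e10/=; apply/andP; split; lra.
have ee1 : e <= e1 by rewrite ge_min lexx.
have e16 : e <= 1 / 16 by rewrite !ge_min lexx orbT.
have er : e <= 3 / 10 - rho by rewrite !ge_min lexx !orbT.
have gap c r : r < `|c| -> c + r <= - rho \/ rho <= c - r ->
    r <= `|1 - c| -> r <= `|2^-1 - c| ->
    \forall n \near \oo, forall x, x \in s n -> r - e < `|x - c|.
  move=> rc rrho r1 r2; apply: (gap_transfer e0 rc st tt).
  near=> n => x.
  have [u tnu urho] : exists2 u : seq R,
    perm_eq (t n) (1 :: nseq d 2^-1 ++ u) & {in u, forall x, `|x| <= rho}.
    by near: n.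
  rewrite (perm_mem tnu) inE mem_cat mem_nseq => /or3P[/eqP->//|/andP[_ /eqP->]//|].
  move=> /urho; rewrite ler_norml ler_normr => /andP[h1 h2].
  by apply/orP; case: rrho => ?; [left|right]; lra.
have n1 : \forall n \near \oo, forall x, x \in s n ->
    (1 / 2 - rho) / 2 - e < `|x - (1 / 2 + rho) / 2|.
  by apply: gap; [rewrite ger0_norm; lra|right; lra|rewrite ger0_norm; lra|
    rewrite ger0_norm; lra].
have n2 : \forall n \near \oo, forall x, x \in s n ->
    1 / 4 - e < `|x - 3 / 4|.
  apply: gap; [rewrite ger0_norm; lra|right; lra|rewrite ger0_norm; lra|].
  by rewrite distrC ger0_norm; lra.
have n3 : \forall n \near \oo, forall x, x \in s n ->
    (B + 1) / 2 - e < `|x - (1 + (B + 1) / 2)|.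
  apply: gap; [rewrite ger0_norm; lra|right; lra| |];
  by rewrite distrC ger0_norm; lra.
have n4 : \forall n \near \oo, forall x, x \in s n ->
    (B + 1) / 2 - e < `|x - (- rho - (B + 1) / 2)|.
  apply: gap; [|left; lra|rewrite ger0_norm; lra|rewrite ger0_norm; lra].
  by rewrite ler0_norm; lra.
have plateau_t c r e' (m : nat) : 0 < e' -> r < `|c| -> rho <= c - r ->
    plateau c r e' 1 + plateau c r e' 2^-1 *+ d = m%:R ->
    (fun n => \sum_(x <- s n) plateau c r e' x) @ \oo --> (m%:R : R).
  move=> e'0 rc rrho hm; apply: (plateau_sum_transfer e'0 rc st tt).
  apply: cvg_near_cst; near=> n.
  have [u tnu urho] : exists2 u : seq R,
    perm_eq (t n) (1 :: nseq d 2^-1 ++ u) & {in u, forall x, `|x| <= rho}.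
    by near: n.
  rewrite (perm_big _ tnu)/= big_cons big_cat/= big_nseq iter_addr_0.
  rewrite [X in _ + (_ + X)]big_seq [X in _ + (_ + X)]big1 ?addr0// => x /urho.
  move=> xrho; apply: plateau_out => //.
  by rewrite ler_normr; apply/orP; right; have := ler_norm x; lra.
have lim1 : (fun n => \sum_(x <- s n) plateau 1 (1 / 4) (1 / 8) x) @ \oo -->
    (1%N%:R : R).
  apply: plateau_t; rewrite ?normr1; try lra.
  rewrite plateau_in ?plateau_out ?mul0rn ?addr0 ?subrr ?normr0//; try lra.
  by rewrite distrC ger0_norm; lra.
have lim2 : (fun n => \sum_(x <- s n) plateau 2^-1 (1 / 8) (1 / 16) x) @ \oo -->
    (d%:R : R).
  apply: plateau_t; rewrite ?ger0_norm; try lra.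
  rewrite plateau_out ?plateau_in ?add0r ?subrr ?normr0//; try lra.
  by rewrite ger0_norm; lra.
have /cvgrPdist_lt/(_ _ ltr01) m1 := lim1.
have /cvgrPdist_lt/(_ _ ltr01) m2 := lim2.
near=> n.
have sBn : \sum_(x <- s n) x ^+ 2 <= B /\ forall x, x \in s n -> `|x| <= B.
  by near: n.
have g1 x : x \in s n -> (1 / 2 - rho) / 2 - e < `|x - (1 / 2 + rho) / 2|.
  by move: x; near: n.
have g2 x : x \in s n -> 1 / 4 - e < `|x - 3 / 4| by move: x; near: n.
have g3 x : x \in s n -> (B + 1) / 2 - e < `|x - (1 + (B + 1) / 2)|.
  by move: x; near: n.
have g4 x : x \in s n -> (B + 1) / 2 - e < `|x - (- rho - (B + 1) / 2)|.
  by move: x; near: n.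
have cl x : x \in s n -> [\/ `|x| <= 3 / 10, `|x - 1 / 2| < e | `|x - 1| < e].
  move=> xs; apply: (gaps_classify (rho := rho) (B := B)) => //.
  - exact: sBn.2.
  - exact: g1.
  - exact: g2.
  - exact: g3.
  - exact: g4.
pose P1 := [set x : R | `|x - 1| < e]; pose P2 := [set x : R | `|x - 1 / 2| < e].
have c1 : \sum_(x <- s n) plateau 1 (1 / 4) (1 / 8) x =
    (count (fun x => x \in P1) (s n))%:R.
  apply: sum_plateau_count => x xs.
  case: (cl x xs) => [|h|h]; last first.
  - by rewrite mem_set// plateau_in//; lra.
  - have h' : 1 / 4 <= `|x - 1|.
      by move: h; rewrite ltr_norml ler_normr => /andP[? ?]; apply/orP; right; lra.
    by rewrite plateau_out// memNset// => hx; have := lt_le_trans hx e16; lra.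
  - move=> h; have h' : 1 / 4 <= `|x - 1|.
      by move: h; rewrite ler_norml ler_normr => /andP[? ?]; apply/orP; right; lra.
    by rewrite plateau_out// memNset// => hx; have := lt_le_trans hx e16; lra.
have c2 : \sum_(x <- s n) plateau 2^-1 (1 / 8) (1 / 16) x =
    (count (fun x => x \in P2) (s n))%:R.
  apply: sum_plateau_count => x xs.
  have half : 2^-1 = 1 / 2 :> R by rewrite div1r.
  case: (cl x xs) => [h|h|h].
  - have h' : 1 / 8 <= `|x - 1 / 2|.
      by move: h; rewrite ler_norml ler_normr => /andP[? ?]; apply/orP; right; lra.
    by rewrite half plateau_out// memNset// => hx; have := lt_le_trans hx e16; lra.
  - by rewrite half mem_set// plateau_in//; lra.
  - have h' : 1 / 8 <= `|x - 1 / 2|.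
      by move: h; rewrite ltr_norml ler_normr => /andP[? ?]; apply/orP; left; lra.
    by rewrite half plateau_out// memNset// => hx; have := lt_le_trans hx e16; lra.
have : `|1 - \sum_(x <- s n) plateau 1 (1 / 4) (1 / 8) x| < 1 by near: n.
rewrite c1 ltr_norml => /andP[k1 _].
have {}k1 : (count (fun x => x \in P1) (s n) < 2)%N by rewrite -(ltr_nat R); lra.
have : `|d%:R - \sum_(x <- s n) plateau 2^-1 (1 / 8) (1 / 16) x| < 1 by near: n.
rewrite c2 ltr_norml => /andP[k2 k3].
have {k2 k3}k2 : count (fun x => x \in P2) (s n) = d.
  apply/eqP; rewrite eqn_leq -ltnS -(ltnS d) -!(ltr_nat R) -!natr1.
  by apply/andP; split; lra.
have /perm_to_rem /permP ps : 1 \in s n by near: n.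
move: k1 k2; rewrite !ps/=.
have -> : 1 \in P1 by apply: mem_set; rewrite /P1/= subrr normr0.
have -> : (1 \in P2) = false.
  by apply: memNset; rewrite /P2/= ger0_norm; lra.
rewrite add0n add1n !ltnS leqn0 => k1 k2; congr (_ + _)%N.
have k1' x : x \in rem 1 (s n) -> ~ P1 x.
  move=> xs P1x; move: k1; rewrite -leqn0 leqNgt -has_count => /hasPn/(_ x xs).
  by rewrite mem_set.
have cI x : x \in rem 1 (s n) -> (x \in I) = ((1 / 2)%R \in I) && (x \in P2).
  move=> xs; case: (cl x (mem_rem xs)) => [h|h|h]; last by case: (k1' x xs).
    have -> : (x \in P2) = false.
      apply: memNset; rewrite /P2 => /= h2; move: h h2.
      by rewrite ler_norml ltr_norml => /andP[? ?] /andP[? ?]; lra.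
    by rewrite andbF; apply: memNset => /I3; apply; rewrite /= in_itv/= -ler_norml.
  by rewrite Ie1 ?(lt_le_trans h)// [X in _ && X]mem_set// andbT.
rewrite (eq_in_count cI); case: ((1 / 2)%R \in I) => /=; first by rewrite muln1.
by rewrite muln0 count_pred0.
Unshelve. all: end_near. Qed.

End interval_counts.

(** * A numerical double sum *)

Section numeric_bound.
Variable R : realType.
Notation N := BinNums.N.

(** The double sum below is evaluated in fixed-point arithmetic on binary
integers, every reciprocal being rounded up to a multiple of 1 / scale. *)
Definition scale : N := BinNat.N.pow (bin_of_nat 10) (bin_of_nat 8).

Definition ceil_inv (k : nat) : N :=
  BinNat.N.succ (BinNat.N.div scale (bin_of_nat (799 - k))).

Definition ceil_inv_sum (m : nat) : N :=
  foldr (fun k acc => BinNat.N.add (ceil_inv k) acc) BinNums.N0 (iota 0 m).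

Definition ceil_inv_dsum : N :=
  let C := ceil_inv_sum 400 in
  foldr (fun k acc => BinNat.N.add (BinNat.N.mul (ceil_inv k)
    (BinNat.N.add C (ceil_inv_sum (400 - k)))) acc) BinNums.N0 (iota 0 400).

(** Locked, so that unification never tries to expand a large integer in unary. *)
Definition toR : N -> R := locked (fun x => (nat_of_bin x)%:R).

Let toRE x : toR x = (nat_of_bin x)%:R.
Proof. by rewrite /toR; unlock. Qed.

Let toR_add x y : toR (BinNat.N.add x y) = toR x + toR y.
Proof. by rewrite !toRE -natrD; congr (_%:R); lia. Qed.

Let toR_mul x y : toR (BinNat.N.mul x y) = toR x * toR y.
Proof. by rewrite !toRE -natrM; congr (_%:R); lia. Qed.

Let toR_le x y : BinNat.N.leb x y -> toR x <= toR y.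
Proof. by move=> xy; rewrite !toRE ler_nat; lia. Qed.

Let toR_ge0 x : 0 <= toR x. Proof. by rewrite toRE ler0n. Qed.

Let toR0 : toR BinNums.N0 = 0.
Proof. by rewrite toRE. Qed.

Let scale_gt0 : 0 < toR scale.
Proof.
rewrite toRE ltr0n; have : BinNat.N.leb (bin_of_nat 1) scale by vm_compute.
by move: scale => z; lia. Qed.

Lemma inv_le_ceil_inv k : (k < 400)%N ->
  (799 - k)%:R^-1 <= toR (ceil_inv k) / toR scale.
Proof.
move=> k400; have k0 : 0 < (799 - k)%:R :> R by rewrite ltr0n; lia.
rewrite ler_pdivlMr// mulrC ler_pdivrMr// !toRE -natrM ler_nat.
have := BinNat.N.mul_succ_div_gt scale (bin_of_nat (799 - k)).
rewrite /ceil_inv; move: (BinNat.N.succ _) => c; move: scale => z h.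
have {h} h : BinNat.N.lt z (BinNat.N.mul (bin_of_nat (799 - k)) c).
  by apply: h; lia.
have : (nat_of_bin z < nat_of_bin (bin_of_nat (799 - k)) * nat_of_bin c)%N by lia.
by rewrite bin_of_natK mulnC => /ltnW.
Qed.

Let sum_le_foldr (f : nat -> R) (F : nat -> N) (z : R) m :
  (forall k, (k < m)%N -> f k <= toR (F k) / z) ->
  \sum_(k < m) f k <=
  toR (foldr (fun k acc => BinNat.N.add (F k) acc) BinNums.N0 (iota 0 m)) / z.
Proof.
move=> fF; rewrite -(big_mkord xpredT f) /index_iota subn0.
have : all (fun k => k < m)%N (iota 0 m).
  by apply/allP => k; rewrite mem_iota.
elim: (iota 0 m) => [|k s IH /= /andP[km /IH sle]].
  by rewrite big_nil toR0 mul0r.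
by rewrite big_cons toR_add mulrDl lerD// fF.
Qed.

Lemma inv_sum_le m : (m <= 400)%N ->
  \sum_(k < m) (799 - k)%:R^-1 <= toR (ceil_inv_sum m) / toR scale.
Proof.
move=> m400; apply: (sum_le_foldr (f := fun k => (799 - k)%:R^-1)) => k km.
by apply: inv_le_ceil_inv; exact: leq_trans km m400.
Qed.

(** The block bound for the trace in [band_trace2_le] with 400 blocks. Its exact
value is about 0.6682, half of the limit 1.3327... plus the discretization
error of the 400 blocks. *)
Lemma inv_dsum_le :
  \sum_(k < 400) \sum_(l < 400)
    (799 - k)%:R^-1 * (799 - l)%:R^-1 * (1 + (k + l < 400)%N%:R)
    <= 1337 / 2000 :> R.
Proof.
have -> : \sum_(k < 400) \sum_(l < 400)
    (799 - k)%:R^-1 * (799 - l)%:R^-1 * (1 + (k + l < 400)%N%:R) =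
  \sum_(k < 400) (799 - k)%:R^-1 * (\sum_(l < 400) (799 - l)%:R^-1 +
     \sum_(l < 400 - k) (799 - l)%:R^-1) :> R.
  apply: eq_bigr => k _.
  have -> : \sum_(l < 400 - k) (799 - l)%:R^-1 =
      \sum_(l < 400) if (l < 400 - k)%N then (799 - l)%:R^-1 else 0 :> R.
    rewrite -big_mkcond/=.
    by rewrite -(big_ord_widen 400 (fun l => (799 - l)%:R^-1)) ?leq_subr.
  rewrite -big_split/= mulr_sumr.
  apply: eq_bigr => l _; rewrite -mulrA; congr (_ * _).
  by rewrite ltn_subRL; case: (k + l < 400)%N; rewrite mulrDr mulr1 ?mulr1 ?mulr0.
have dle : \sum_(k < 400) (799 - k)%:R^-1 * (\sum_(l < 400) (799 - l)%:R^-1 +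
     \sum_(l < 400 - k) (799 - l)%:R^-1) <= toR ceil_inv_dsum / toR scale ^+ 2 :> R.
  apply: (sum_le_foldr (f := fun k => (799 - k)%:R^-1 *
    (\sum_(l < 400) (799 - l)%:R^-1 + \sum_(l < 400 - k) (799 - l)%:R^-1))) => k k400.
  rewrite toR_mul toR_add expr2 invfM mulrACA.
  apply: ler_pM; rewrite ?invr_ge0 ?addr_ge0 ?sumr_ge0//.
    exact: inv_le_ceil_inv.
  by rewrite mulrDl lerD// inv_sum_le// leq_subr.
apply: le_trans dle _.
have : BinNat.N.leb (BinNat.N.mul (bin_of_nat 2000) ceil_inv_dsum)
    (BinNat.N.mul (bin_of_nat 1337) (BinNat.N.mul scale scale)).
  by vm_compute; reflexivity.
move: scale_gt0; move: ceil_inv_dsum scale => x z z0 /toR_le.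
rewrite !toR_mul (toRE (bin_of_nat 2000)) (toRE (bin_of_nat 1337)) !bin_of_natK.
move=> h; rewrite ler_pdivrMr ?exprn_gt0// mulrAC ler_pdivlMr ?ltr0n//.
by rewrite mulrC expr2.
Qed.
End numeric_bound.

(** * The reference walk on a line *)

Section band.
Variable R : realType.

Definition band N (a b : nat) := (a <= b + N)%N && (b <= a + N)%N.

Definition band_mx N : 'M[R]_(N.*2.+1) := \matrix_(a, b) (band N a b)%:R.

Lemma bandC N a b : band N a b = band N b a.
Proof. by rewrite /band andbC. Qed.

Lemma band_mx_sym N : (band_mx N)^T = band_mx N.
Proof. by apply/matrixP => a b; rewrite !mxE bandC. Qed.

(** At most one of the truncated differences is nonzero, so this is
[2N + 1 - `|a - N|]. *)
Definition band_degree N (a : nat) := (N.*2.+1 - (N - a) - (a - N))%N.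

Lemma band_row_sum N (a : 'I_N.*2.+1) :
  row_sum (band_mx N) a = (band_degree N a)%:R.
Proof.
rewrite /row_sum; under eq_bigr do rewrite mxE.
rewrite -natr_sum; congr (_%:R).
transitivity (\sum_(a - N <= b < minn (a + N).+1 N.*2.+1) 1)%N; last first.
  by rewrite sum_nat_const_nat muln1 /band_degree; have := ltn_ord a; lia.
rewrite (big_nat_widen _ _ N.*2.+1) ?geq_minr//.
rewrite (big_nat_widenl _ 0)//= big_mkord [RHS]big_mkcond/=.
apply: eq_bigr => b _; have := ltn_ord b; rewrite /band.
by case: ifP; lia.
Qed.

Lemma band_degree_ge N (a : 'I_N.*2.+1) : (N < band_degree N a)%N.
Proof. by have := ltn_ord a; rewrite /band_degree; lia. Qed.

Lemma band_row_sum_gt0 N (a : 'I_N.*2.+1) : 0 < row_sum (band_mx N) a.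
Proof. by rewrite band_row_sum ltr0n (leq_ltn_trans _ (band_degree_ge a)). Qed.

(** The neighbours of [a] are stable under the reflection [b |-> a + N - b], so
the mean of [b] over them is [(a + N) / 2]. *)
Lemma band_mx_linear N (a : 'I_N.*2.+1) :
  \sum_b band_mx N a b * (b%:R - N%:R) =
  2^-1 * (row_sum (band_mx N) a * (a%:R - N%:R)).
Proof.
pose h (b : 'I_N.*2.+1) : 'I_N.*2.+1 := inord (a + N - b).
have hE (b : 'I_N.*2.+1) : band N a b -> h b = (a + N - b)%N :> nat.
  by move=> ab; rewrite inordK//; move: ab; have := ltn_ord a;
    have := ltn_ord b; rewrite /band; lia.
have hb (b : 'I_N.*2.+1) : band N a b -> band N a (h b).
  by move=> ab; rewrite hE//; move: ab; have := ltn_ord b; rewrite /band; lia.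
have hK (b : 'I_N.*2.+1) : band N a b -> h (h b) = b.
  by move=> ab; apply/val_inj; rewrite /= hE ?hb// hE//; move: ab; rewrite /band; lia.
have sumE (F : 'I_N.*2.+1 -> R) :
    \sum_b band_mx N a b * F b = \sum_(b : 'I_N.*2.+1 | band N a b) F b.
  rewrite [RHS]big_mkcond/=; apply: eq_bigr => b _; rewrite mxE.
  by case: ifP => _; rewrite ?mul1r ?mul0r.
have -> : row_sum (band_mx N) a = \sum_(b : 'I_N.*2.+1 | band N a b) 1.
  by rewrite -sumE; apply: eq_bigr => b _; rewrite mulr1.
rewrite sumE; apply: (@mulfI _ 2) => //; rewrite mulrA divff// mul1r.
rewrite mulr2n mulrDl mul1r [X in _ + X](reindex_onto h h)/=; last first.
  by move=> b; exact: hK.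
rewrite [X in _ + X](eq_bigl (fun b : 'I__ => band N a b)); last first.
  move=> b; apply/andP/idP => [[h1 /eqP h2]|ab].
    by rewrite -h2; exact: hb.
  by rewrite hb// hK.
rewrite -big_split/= mulr_suml; apply: eq_bigr => b ab.
rewrite mul1r hE// natrB ?natrD; first by ring.
by move: ab; rewrite /band; lia.
Qed.

Definition band_spectrum N : seq R := spectrum (normalize_mx (band_mx N)).

Definition band_kernel N (a b : 'I_N.*2.+1) : R :=
  (band N a b)%:R / (band_degree N a)%:R.

Lemma band_power_sum N m :
  \sum_(x <- band_spectrum N) x ^+ m = ktrace (band_kernel (N := N)) m.
Proof.
rewrite normalize_mx_power_sum; [|exact: band_mx_sym|exact: band_row_sum_gt0].
by apply: eq_ktrace => a b; rewrite band_row_sum mxE.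
Qed.

Lemma mem1_band_spectrum N : 1 \in band_spectrum N.
Proof.
apply: (@mem_spectrum_normalize _ _ _ (band_mx_sym N)
  (@band_row_sum_gt0 N) (fun=> 1) 1 ord0); first exact: oner_neq0.
by move=> i; rewrite mul1r mulr1; apply: eq_bigr => j _; rewrite mulr1.
Qed.

Lemma memhalf_band_spectrum N : (0 < N)%N -> 2^-1 \in band_spectrum N.
Proof.
move=> N0; apply: (@mem_spectrum_normalize _ _ _ (band_mx_sym N)
  (@band_row_sum_gt0 N) (fun b => b%:R - N%:R) 2^-1 ord0).
  by rewrite sub0r oppr_eq0 pnatr_eq0 -lt0n.
exact: band_mx_linear.
Qed.

Lemma sum_centered N (F : nat -> R) : \sum_(a < N.*2.+1) F a =
  F N + \sum_(i < N) (F (N - i.+1)%N + F (N + i.+1)%N).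
Proof.
have NL : (N <= N.*2.+1)%N by lia.
have NL' : (N < N.*2.+1)%N by lia.
rewrite -(big_mkord xpredT F) (big_cat_nat (n := N))//= [X in _ + X]big_ltn//.
rewrite big_split/= addrCA; congr (_ + (_ + _)).
  by rewrite big_mkord (reindex_inj rev_ord_inj)/=.
rewrite -{1}[N.+1]add0n big_addn big_mkord.
have -> : (N.*2.+1 - N.+1 = N)%N by lia.
by apply: eq_bigr => i _; congr (F _); lia.
Qed.

Lemma sum_blocks M g (H : nat -> R) : (0 < g)%N ->
  \sum_(i < M * g) H (i %/ g)%N = g%:R * \sum_(k < M) H k.
Proof.
move=> g0; elim: M => [|M IH]; first by rewrite mul0n !big_ord0 mulr0.
rewrite big_ord_recr/= mulrDr -IH.
rewrite -!(big_mkord xpredT (fun i => H (i %/ g)%N)) mulSnr.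
rewrite (big_cat_nat (n := M * g))//=; last exact: leq_addr.
congr (_ + _); rewrite -{1}[(M * g)%N]add0n big_addn addKn big_mkord.
rewrite (eq_bigr (fun=> H M)); last first.
  by move=> i _; rewrite addnC divnMDl// divn_small ?addn0.
by rewrite sumr_const card_ord mulr_natl.
Qed.

(** In terms of the distances [i + 1] and [j + 1] to the centre, two points on the
same side are always adjacent and two points on opposite sides are adjacent when
the distances add up to at most [N]. The central row and column contribute
[O(1/N)]. *)
Lemma band_trace2_split N : ktrace (band_kernel (N := N)) 2 <=
  2 / N.+1%:R + \sum_(i < N) \sum_(j < N)
    2 * ((N.*2 - i)%:R^-1 * (N.*2 - j)%:R^-1 * (1 + (i + j + 2 <= N)%N%:R)).
Proof.
pose f (a : nat) : R := (band_degree N a)%:R^-1.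
pose G (a b : nat) : R := (band N a b)%:R * (f a * f b).
have -> : ktrace (band_kernel (N := N)) 2 =
    \sum_(a < N.*2.+1) \sum_(b < N.*2.+1) G a b.
  apply: eq_bigr => a _; rewrite /= -/(kpow _ 1 _ _); apply: eq_bigr => b _.
  rewrite -/(kpow _ 1 _ _) kpow1 /band_kernel (bandC N b a) /G /f.
  by case: (band N a b); rewrite ?mul1r ?mul0r.
have f0 a : 0 <= f a by rewrite /f invr_ge0.
have G0 a b : 0 <= G a b by rewrite /G !mulr_ge0.
have fN a : (a < N.*2.+1)%N -> f a <= N.+1%:R^-1.
  move=> aL; rewrite /f lef_pV2 ?posrE ?ltr0n ?ler_nat//.
    exact: (band_degree_ge (Ordinal aL)).
  by apply: leq_ltn_trans (band_degree_ge (Ordinal aL)).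
have fc : f N = N.*2.+1%:R^-1 by rewrite /f /band_degree !subnn !subn0.
have Gc a : (a < N.*2.+1)%N -> G a N <= N.*2.+1%:R^-1 / N.+1%:R.
  move=> aL; rewrite /G -fc mulrC -[leRHS]mulr1 (mulrC (f a)).
  by apply: ler_pM; rewrite ?mulr_ge0// ?ler_wpM2l ?fN//; case: (band _ _ _).
rewrite (sum_centered N (fun a => \sum_(b < N.*2.+1) G a b)).
rewrite (eq_bigr (fun i : 'I_N =>
  (G (N - i.+1)%N N + G (N + i.+1)%N N) +
  \sum_(j < N) (G (N - i.+1)%N (N - j.+1)%N + G (N - i.+1)%N (N + j.+1)%N +
   (G (N + i.+1)%N (N - j.+1)%N + G (N + i.+1)%N (N + j.+1)%N)))); last first.
  move=> i _; rewrite (sum_centered N (G (N - i.+1)%N)).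
  rewrite (sum_centered N (G (N + i.+1)%N)) addrACA; congr (_ + _).
  by rewrite -big_split/=; apply: eq_bigr => j _.
rewrite big_split/= addrA; apply: lerD.
  have -> : 2 / N.+1%:R = N.*2.+1%:R^-1 / N.+1%:R * N.*2.+1%:R
      + N.*2.+1%:R^-1 / N.+1%:R + N.*2.+1%:R^-1 / N.+1%:R * N.*2%:R :> R.
    rewrite -[N.*2.+1]addn1 natrD -[N.+1]addn1 natrD.
    have : 0 <= N%:R :> R by []; have : 0 <= N.*2%:R :> R by [].
    move=> h1 h2; field; apply/andP; split; rewrite gt_eqF//; lra.
  rewrite -addrA; apply: lerD.
    apply: le_trans (_ : \sum_(b < N.*2.+1) N.*2.+1%:R^-1 / N.+1%:R <= _).
      apply: ler_sum => b _; rewrite /G bandC (mulrC (f N)).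
      by apply: Gc; exact: ltn_ord.
    by rewrite sumr_const card_ord mulr_natr.
  apply: le_trans (_ : \sum_(i < N) (N.*2.+1%:R^-1 / N.+1%:R) *+ 2 <= _).
    apply: ler_sum => i _; rewrite mulr2n; apply: lerD; apply: Gc;
    by have := ltn_ord i; lia.
  rewrite sumr_const card_ord -mulrnA -mul2n mulr_natr lerDr.
  by rewrite mulr_ge0 ?invr_ge0.
apply: ler_sum => i _; apply: ler_sum => j _.
have iN := ltn_ord i; have jN := ltn_ord j.
have fm k : (k < N)%N -> f (N - k.+1)%N = (N.*2 - k)%:R^-1.
  by move=> kN; rewrite /f /band_degree; congr (_%:R^-1); lia.
have fp k : (k < N)%N -> f (N + k.+1)%N = (N.*2 - k)%:R^-1.
  by move=> kN; rewrite /f /band_degree; congr (_%:R^-1); lia.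
rewrite /G !fm// !fp//.
have -> : band N (N - i.+1) (N - j.+1) by rewrite /band; lia.
have -> : band N (N + i.+1) (N + j.+1) by rewrite /band; lia.
have -> : band N (N - i.+1) (N + j.+1) = (i + j + 2 <= N)%N by rewrite /band; lia.
have -> : band N (N + i.+1) (N - j.+1) = (i + j + 2 <= N)%N by rewrite /band; lia.
rewrite le_eqVlt; apply/orP; left; apply/eqP => /=.
by case: (i + j + 2 <= N)%N => /=; ring.
Qed.

(** With [N = 400 * g], the indices are grouped into 400 blocks of length [g] and
the reciprocal of the degree is bounded by its maximum on the block. The
condition [3 <= g] makes the contribution [2 / (N + 1)] of the centre smaller
than the room left by the numerical bound. *)
Lemma band_trace2_le g : (3 <= g)%N ->
  ktrace (band_kernel (N := 400 * g)) 2 <= 5 / 4 + (299 / 1000) ^+ 2.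
Proof.
move=> g3; set N := (400 * g)%N.
have g0 : 0 < g%:R :> R by rewrite ltr0n; lia.
apply: le_trans (band_trace2_split N) _.
apply: le_trans (_ : 2 / 1000 + 1337 / 1000 <= _); last by rewrite expr2; lra.
apply: lerD.
  rewrite ler_wpM2l// lef_pV2 ?posrE ?ltr0n// ler_nat; lia.
pose v k : R := (799 - k)%:R^-1.
pose H k l := v k * v l * (1 + (k + l < 400)%N%:R).
apply: le_trans (_ : \sum_(i < N) \sum_(j < N)
   2 * (g%:R^-1 ^+ 2 * H (i %/ g)%N (j %/ g)%N) <= _).
  apply: ler_sum => i _; apply: ler_sum => j _; rewrite ler_wpM2l//.
  have wv (k : 'I_N) : (N.*2 - k)%:R^-1 <= g%:R^-1 * v (k %/ g)%N.
    have kN : (k < 400 * g)%N := ltn_ord k.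
    have kg : (k %/ g < 400)%N by rewrite ltn_divLR//; lia.
    have kk : (g * (799 - k %/ g) <= N.*2 - k)%N.
      have := divn_eq k g; have := ltn_pmod k (ltnW (ltnW g3)); rewrite /N.
      by move: (k %/ g)%N (k %% g)%N kg => q r; nia.
    have k0 : (0 < g * (799 - k %/ g))%N.
      by rewrite muln_gt0 subn_gt0 (ltn_trans kg)// (ltnW (ltnW g3)).
    rewrite /v -invfM -natrM lef_pV2 ?posrE ?ltr0n ?ler_nat//.
    exact: leq_trans kk.
  rewrite /H expr2 mulrA mulrACA; apply: ler_pM; rewrite ?mulr_ge0 ?invr_ge0//.
    by apply: ler_pM; rewrite ?invr_ge0.
  rewrite lerD2l; case: (leqP (i + j + 2) N) => // ij.
  have -> // : (i %/ g + j %/ g < 400)%N.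
  rewrite -(ltn_pmul2r (ltnW (ltnW g3))) mulnDl.
  by have := leq_trunc_div i g; have := leq_trunc_div j g; rewrite -/N; lia.
have -> : \sum_(i < N) \sum_(j < N) 2 * (g%:R^-1 ^+ 2 * H (i %/ g)%N (j %/ g)%N)
    = 2 * \sum_(k < 400) \sum_(l < 400) H k l.
  under eq_bigr do rewrite -mulr_sumr -mulr_sumr.
  rewrite -mulr_sumr -mulr_sumr; congr (_ * _).
  have gN : (0 < g)%N by lia.
  under eq_bigr => i _ do rewrite (sum_blocks 400 (fun l => H (i %/ g)%N l) gN).
  rewrite (sum_blocks 400 (fun k => g%:R * \sum_(l < 400) H k l) gN).
  by rewrite -mulr_sumr; field; rewrite gt_eqF.
by have := inv_dsum_le R; rewrite -/(H _ _); lra.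
Qed.

(** The squares of all eigenvalues add up to at most [1 + 1/4 + (299/1000)^2], and
the known eigenvalues use up [1 + 1/4]. *)
Lemma band_spectrumP g : (3 <= g)%N -> exists2 u : seq R,
  perm_eq (band_spectrum (400 * g)) [:: 1, 2^-1 & u] &
  {in u, forall x, `|x| <= 299 / 1000}.
Proof.
move=> g3; have g0 : (0 < 400 * g)%N by lia.
have p1 := perm_to_rem (mem1_band_spectrum (400 * g)).
have : 2^-1 \in rem 1 (band_spectrum (400 * g)).
  have := memhalf_band_spectrum g0; rewrite (perm_mem p1) inE => /orP[|//].
  by move=> /eqP ?; exfalso; lra.
move=> /perm_to_rem p2; set u := rem 2^-1 _ in p2.
have p : perm_eq (band_spectrum (400 * g)) [:: 1, 2^-1 & u].
  by rewrite (perm_trans p1)// perm_cons.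
exists u => // x xu.
have := band_trace2_le g3; rewrite -band_power_sum (perm_big _ p)/= !big_cons.
have c0 : 0 <= 299 / 1000 :> R by rewrite divr_ge0 ?ler0n.
move: (299 / 1000 : R) c0 => c c0; rewrite (big_rem x)//=.
have : 0 <= \sum_(y <- rem x u) y ^+ 2 by apply: sumr_ge0 => y _; exact: sqr_ge0.
move: (\sum_(_ <- _) _) => s s0 h.
rewrite -(@ler_pXn2r _ 2) ?nnegrE// real_normK ?num_real//.
by move: h; rewrite expr1n exprVn; lra.
Qed.

End band.

(** * Products of eigenvalues *)

Section tensor.
Variable R : realType.
Implicit Types (k u : seq R) (d m : nat).

(** The eigenvalues of the d-fold tensor power of an operator with spectrum [k];
it enters only through its power sums. *)
Fixpoint tensor_spectrum k d : seq R :=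
  if d is d'.+1 then [seq x * y | x <- k, y <- tensor_spectrum k d'] else [:: 1].

Lemma tensor_power_sum k d m :
  \sum_(x <- tensor_spectrum k d) x ^+ m = (\sum_(x <- k) x ^+ m) ^+ d.
Proof.
elim: d => [|d IH]; first by rewrite big_seq1 expr1n expr0.
rewrite exprS -IH mulr_suml big_allpairs_dep; apply: eq_bigr => x _.
by rewrite mulr_sumr; apply: eq_bigr => y _; rewrite exprMn.
Qed.

(** Pascal's rule: the factor 1 keeps [2^-j], the factor 1/2 turns [2^-(j-1)] into
[2^-j]. *)
Lemma tensor_count k u d j : perm_eq k [:: 1, 2^-1 & u] ->
  ('C(d, j) <= count_mem (2 ^- j) (tensor_spectrum k d))%N.
Proof.
move=> ku; elim: d j => [|d IH] j.
  by case: j => [|j]; rewrite ?bin0n//= expr0 invr1 eqxx.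
have -> : count_mem (2 ^- j) (tensor_spectrum k d.+1) = (\sum_(x <- k)
    count (fun y => (x * y)%R == (2 ^- j)%R) (tensor_spectrum k d))%N.
  rewrite -sum1_count big_mkcond big_allpairs_dep/=; apply: eq_bigr => x _.
  by rewrite -sum1_count [RHS]big_mkcond.
rewrite (perm_big _ ku)/= !big_cons addnA.
apply: leq_trans (leq_addr _ _).
rewrite (eq_count (a2 := pred1 (2 ^- j))); last by move=> y; rewrite /= mul1r.
case: j => [|j]; first by rewrite bin0 -(bin0 d) (leq_trans (IH 0%N))// leq_addr.
rewrite binS leq_add// (eq_count (a2 := pred1 (2 ^- j)))// => y /=.
by rewrite exprS invfM (inj_eq (mulfI _))// invr_eq0.
Qed.

Lemma tensor_spectrumP k u d (rho : R) : 4^-1 <= rho -> rho <= 1 ->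
  perm_eq k [:: 1, 2^-1 & u] -> {in u, forall x, `|x| <= rho} ->
  exists2 v : seq R, perm_eq (tensor_spectrum k d) (1 :: nseq d 2^-1 ++ v) &
    {in v, forall x, `|x| <= rho}.
Proof.
move=> rho4 rho1 ku urho; elim: d => [|d [v tv vrho]]; first by exists [::].
set t' := 1 :: _ in tv.
have tv1 y : y \in t' -> `|y| <= 1.
  rewrite inE mem_cat mem_nseq => /or3P[/eqP->|/andP[_ /eqP->]|/vrho].
  - by rewrite normr1.
  - by rewrite ger0_norm; lra.
  - by move=> ?; lra.
exists (v ++ [seq 2^-1 * y | y <- nseq d 2^-1 ++ v] ++ [seq x * y | x <- u, y <- t']).
  have p : perm_eq (tensor_spectrum k d.+1)
      [seq x * y | x <- [:: 1, 2^-1 & u], y <- t'].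
    exact: perm_allpairs.
  apply: (perm_trans p); rewrite /t' /= (eq_map (@mul1r R)) map_id !mulr1.
  by apply/permP => a; rewrite /= !map_cat !count_cat /= !count_cat; lia.
move=> x; rewrite !mem_cat => /or3P[/vrho//|/mapP[y]|/allpairsP[[y z] [/= yu zt ->]]].
  rewrite mem_cat mem_nseq => yv ->; rewrite normrM ger0_norm//.
  move: yv => /orP[/andP[_ /eqP->]|/vrho]; last by lra.
  by rewrite ger0_norm; lra.
rewrite normrM; apply: le_trans (_ : rho * 1 <= _); last by rewrite mulr1.
by apply: ler_pM => //; [exact: urho|exact: tv1].
Qed.
End tensor.

(** * Cells of the cube *)

Section cells.
Variable R : realType.

(** The truncation at [2N] puts the end point [x = 1] into the last cell. *)
Definition cell N (x : R) : 'I_N.*2.+1 :=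
  inord (minn (Num.truncn ((x + 1) * N.*2.+1%:R / 2)) N.*2).

Lemma cell_bounds N (x : R) : `|x| <= 1 ->
  (cell N x)%:R <= (x + 1) * N.*2.+1%:R / 2 <= (cell N x).+1%:R.
Proof.
rewrite ler_norml => /andP[x0 x1].
have t0 : 0 <= (x + 1) * N.*2.+1%:R / 2 by rewrite !mulr_ge0//; lra.
have t1 : (x + 1) * N.*2.+1%:R / 2 <= N.*2.+1%:R.
  by rewrite ler_pdivrMr// mulrC ler_wpM2l//; lra.
rewrite /cell inordK ?ltnS ?geq_minr//.
have /andP[h1 h2] := truncn_itv t0; move: h1 h2.
set t := Num.truncn _; move=> h1 h2.
have [tN|Nt] := leqP t N.*2; first by rewrite h1 ltW.
apply/andP; split; last exact: t1.
by apply: le_trans h1; rewrite ler_nat ltnW.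
Qed.

(** The cell indices for which the cells alone do not decide whether two points
are within distance 1, because the cells have length [2 / (2N + 1)]. *)
Definition border N (a b : nat) :=
  [|| a == (b + N)%N, a == (b + N).+1, b == (a + N)%N | b == (a + N).+1].

Lemma cell_band N (x y : R) : `|x| <= 1 -> `|y| <= 1 ->
  ~~ border N (cell N x) (cell N y) ->
  (`|x - y| <= 1) = band N (cell N x) (cell N y).
Proof.
move=> /(@cell_bounds N)/andP[x0 x1] /(@cell_bounds N)/andP[y0 y1].
set a := cell N x in x0 x1 *; set b := cell N y in y0 y1 *.
have L0 : 0 < N.*2.+1%:R :> R by [].
have LE : N.*2.+1%:R = N%:R + N%:R + 1 :> R by rewrite -natr1 -addnn natrD.
have aS : a.+1%:R = a%:R + 1 :> R by rewrite -natr1.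
have bS : b.+1%:R = b%:R + 1 :> R by rewrite -natr1.
rewrite aS in x1; rewrite bS in y1.
move: LE x0 x1 y0 y1 L0; move: (N.*2.+1%:R : R) => L LE x0 x1 y0 y1 L0 nb.
apply/idP/idP => [|ab].
  rewrite ler_norml => /andP[h1 h2].
  have h3 : (x + 1) * L / 2 - (y + 1) * L / 2 <= L / 2 by nra.
  have h4 : (y + 1) * L / 2 - (x + 1) * L / 2 <= L / 2 by nra.
  have ab : (a < b + N + 2)%N.
    by rewrite -(ltr_nat R) !natrD; lra.
  have ba : (b < a + N + 2)%N.
    by rewrite -(ltr_nat R) !natrD; lra.
  by move: nb ab ba; rewrite /border /band; lia.
have [ab1 ba1] : (a.+1 <= b + N)%N /\ (b.+1 <= a + N)%N.
  by move: nb ab; rewrite /border /band; lia.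
move: ab1 ba1; rewrite -!(ler_nat R) !natrD -!natr1 => ab1 ba1.
have h3 : (x + 1) * L / 2 - (y + 1) * L / 2 <= L / 2 by lra.
have h4 : (y + 1) * L / 2 - (x + 1) * L / 2 <= L / 2 by lra.
by rewrite ler_norml; apply/andP; split; nra.
Qed.

Lemma sum_indicator_le1 (T : finType) (P : pred T) :
  (forall b c, P b -> P c -> b = c) -> \sum_b (P b)%:R <= 1 :> R.
Proof.
move=> h; have [b Pb|P0] := pickP P; last first.
  by rewrite big1 ?ler01// => b _; rewrite P0.
rewrite (bigD1 b)//= Pb big1 ?addr0// => c cb.
by case: (boolP (P c)) => // Pc; rewrite (h _ _ Pc Pb) eqxx in cb.
Qed.

Lemma border_count N (a : nat) : \sum_(b < N.*2.+1) (border N a b)%:R <= 4 :> R.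
Proof.
apply: le_trans (_ : \sum_(b < N.*2.+1) ((a == b + N)%N%:R + (a == (b + N).+1)%N%:R +
  (b == a + N :> nat)%N%:R + (b == (a + N).+1 :> nat)%N%:R) <= _).
  apply: ler_sum => b _; rewrite -!natrD ler_nat /border.
  by do 4 case: (_ == _).
have -> : 4 = 1 + 1 + 1 + 1 :> R by ring.
rewrite !big_split/=; apply: lerD; [apply: lerD; [apply: lerD|]|].
all: by apply: sum_indicator_le1 => b c /eqP h1 /eqP h2; apply/val_inj => /=; lia.
Qed.

Lemma sum_coordinate (T : finType) d (l : 'I_d) (F : T -> R) :
  \sum_(b : {ffun 'I_d -> T}) F (b l) = #|T|%:R ^+ d.-1 * \sum_a F a.
Proof.
pose G (l' : 'I_d) (a : T) := if l' == l then F a else 1.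
rewrite (eq_bigr (fun b : {ffun 'I_d -> T} => \prod_l' G l' (b l'))); last first.
  move=> b _; rewrite (bigD1 l)//= {1}/G eqxx big1 ?mulr1// => l' ll'.
  by rewrite /G (negbTE ll').
rewrite -(bigA_distr_bigA G) (bigD1 l)//= mulrC; congr (_ * _); last first.
  by apply: eq_bigr => a _; rewrite /G eqxx.
rewrite (eq_bigr (fun=> #|T|%:R)); last first.
  move=> l' ll'; rewrite (eq_bigr (fun=> 1)) ?sumr_const// => a _.
  by rewrite /G (negbTE ll').
by rewrite prodr_const cardC1 card_ord.
Qed.

Section boxes.
Variables (d N : nat).
Local Notation L := N.*2.+1.
Local Notation T := {ffun 'I_d -> 'I_L}.

Definition box_cell (x : d.-tuple R) : T := [ffun l => cell N (tnth x l)].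

Definition box_band (a b : T) : R := \prod_l (band N (a l) (b l))%:R.

(** A union bound for the event that some coordinate is undecided. *)
Definition box_border (a b : T) : R := \sum_l (border N (a l) (b l))%:R.

Lemma box_band_ge0 a b : 0 <= box_band a b.
Proof. by apply: prodr_ge0. Qed.

Lemma box_band_le1 a b : box_band a b <= 1.
Proof. by apply: prodr_ile1 => l; case: (band _ _ _); rewrite ?ler01 ?lexx. Qed.

Lemma box_border_ge0 a b : 0 <= box_border a b.
Proof. by apply: sumr_ge0. Qed.

Lemma box_border_sum a : \sum_b box_border a b <= (4 * d)%:R * L%:R ^+ d.-1.
Proof.
rewrite /box_border exchange_big/=.
apply: le_trans (_ : \sum_(l < d) 4 * L%:R ^+ d.-1 <= _); last first.
  by rewrite sumr_const card_ord -mulrnAl natrM mulr_natr.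
apply: ler_sum => l _.
rewrite (sum_coordinate l (fun c : 'I_L => (border N (a l) c)%:R)) card_ord mulrC.
by rewrite ler_wpM2r ?exprn_ge0// border_count.
Qed.

Lemma box_band_sum a :
  \sum_b box_band a b = \prod_l (band_degree N (a l))%:R.
Proof.
rewrite /box_band -(bigA_distr_bigA (fun l (b : 'I_L) => (band N (a l) b)%:R)).
apply: eq_bigr => l _; rewrite -band_row_sum /row_sum.
by apply: eq_bigr => b _; rewrite mxE.
Qed.

Lemma box_band_sum_ge a : (L%:R / 2) ^+ d <= \sum_b box_band a b.
Proof.
rewrite box_band_sum -[X in _ ^+ X]card_ord -prodr_const; apply: ler_prod => l _.
rewrite divr_ge0//= ler_pdivrMr// -natrM ler_nat.
by have := band_degree_ge (a l); lia.
Qed.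

Lemma adjacency_band (x y : d.-tuple R) :
  (forall l, `|tnth x l| <= 1) -> (forall l, `|tnth y l| <= 1) ->
  `|(sup_dist x y <= 1)%R%:R - box_band (box_cell x) (box_cell y)| <=
  box_border (box_cell x) (box_cell y).
Proof.
move=> x1 y1.
have [/existsP[l bl]|/existsPn nb] :=
    boolP [exists l, border N (box_cell x l) (box_cell y l)].
  apply: le_trans (_ : 1 <= _).
    have := box_band_ge0 (box_cell x) (box_cell y).
    have := box_band_le1 (box_cell x) (box_cell y).
    by rewrite ler_norml; case: (sup_dist _ _ <= 1) => /=; lra.
  by rewrite /box_border (bigD1 l)//= bl lerDl sumr_ge0.
have eq1 l : (`|tnth x l - tnth y l| <= 1) = band N (box_cell x l) (box_cell y l).
  by move: (nb l); rewrite !ffunE => /cell_band ->.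
suff -> : (sup_dist x y <= 1)%R%:R = box_band (box_cell x) (box_cell y).
  by rewrite subrr normr0 box_border_ge0.
rewrite /box_band; have [xy|/negP xy] := boolP (sup_dist x y <= 1).
  rewrite big1// => l _; rewrite -eq1.
  by move: xy => /bigmax_leP[_ /(_ l isT) ->].
have [/forallP h|/forallPn[l nl]] :=
    boolP [forall l, band N (box_cell x l) (box_cell y l)].
  by case: xy; apply/bigmax_leP; split => // l _; rewrite eq1.
by rewrite (bigD1 l)//= (negbTE nl) mul0r.
Qed.

End boxes.
End cells.

(** * The graph on a sample and the walk on the cells *)

Section graph_comparison.
Variables (R : realType) (d N n : nat) (p : nat -> d.-tuple R).
Hypotheses (d0 : (0 < d)%N) (n0 : (0 < n)%N).
Hypothesis p1 : forall i l, `|tnth (p i) l| <= 1.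
Local Notation L := N.*2.+1.
Local Notation T := {ffun 'I_d -> 'I_L}.

Definition cell_frequency (c : T) : R :=
  \sum_(i < n) (box_cell N (p i) == c)%:R * n%:R^-1.

Lemma adjacency_degree_gt0 (i : 'I_n) : 0 < row_sum (adjacency 1 p n) i.
Proof.
rewrite /row_sum (bigD1 i)//= mxE; apply: ltr_pwDl; last first.
  by apply: sumr_ge0 => j _; rewrite mxE.
suff -> : sup_dist (p i) (p i) <= 1 by [].
by apply/bigmax_leP; split => // l _; rewrite subrr normr0.
Qed.

Lemma adjacency_sym : (adjacency 1 p n)^T = adjacency 1 p n.
Proof.
apply/matrixP => i j; rewrite !mxE; congr (_ <= 1)%R%:R.
by apply: eq_bigr => k _; rewrite distrC.
Qed.

Lemma normalized_adjacencyE :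
  normalized_adjacency 1 p n = normalize_mx (adjacency 1 p n).
Proof. by []. Qed.

Lemma mem1_graph_spectrum : 1 \in spectrum (normalized_adjacency 1 p n).
Proof.
rewrite normalized_adjacencyE.
apply: (@mem_spectrum_normalize _ _ _ adjacency_sym adjacency_degree_gt0
  (fun=> 1) 1 (Ordinal n0)); first exact: oner_neq0.
by move=> i; rewrite mul1r mulr1; apply: eq_bigr => j _; rewrite mulr1.
Qed.

(* u is the volume of a cell, 1 / C a lower bound for all degrees, and e the
   uniform error of the degrees. *)
Let u : R := (L%:R ^+ d)^-1.
Let C : R := 2 ^+ d.+1.
Let e : R := (8 * d + 1)%:R / L%:R.

Hypothesis freq : forall c, `|cell_frequency c - u| <= u / L%:R.
Hypothesis e_small : 2 * C * e <= 2.

Let q := cell_frequency.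
Let cc (i : 'I_n) : T := box_cell N (p i).
Let h (i j : 'I_n) : R := adjacency 1 p n i j.
Let L0 : 0 < L%:R :> R. Proof. by []. Qed.
Let u0 : 0 < u. Proof. by rewrite invr_gt0 exprn_gt0. Qed.
Let C1 : 1 <= C. Proof. by rewrite exprn_ege1// ler1n. Qed.
Let C0 : 0 < C. Proof. by rewrite exprn_gt0. Qed.
Let nR0 : 0 < n%:R :> R. Proof. by rewrite ltr0n. Qed.
Let cardT : #|{: T}|%:R * u = 1 :> R.
Proof. by rewrite card_ffun !card_ord natrX divff// expf_neq0// gt_eqF. Qed.

Let q2 c : 0 <= q c <= 2 * u.
Proof.
rewrite /q; apply/andP; split; first by apply: sumr_ge0 => i _; rewrite mulr_ge0.
have uL : u / L%:R <= u.
  by rewrite ler_pdivrMr// ler_peMr ?(ltW u0)// ler1n.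
have := freq c; rewrite ler_norml => /andP[_].
by move: uL; move: (u / _) (cell_frequency c) => a b; lra.
Qed.

Let delta (c : T) := \sum_b u * box_band R c b.

(* Every index has more than half of all indices as neighbours. *)
Let delta_ge c : 2 * C^-1 <= delta c.
Proof.
rewrite /delta -mulr_sumr; apply: le_trans (_ : u * (L%:R / 2) ^+ d <= _).
  rewrite expr_div_n mulrA mulVf ?expf_neq0 ?gt_eqF// mul1r /C exprS invfM mulrA.
  by rewrite divff// mul1r.
by rewrite ler_wpM2l ?(ltW u0)// box_band_sum_ge.
Qed.

Let border_mean (c : T) : \sum_b q b * box_border R c b <= (8 * d)%:R / L%:R.
Proof.
apply: le_trans (_ : \sum_b 2 * u * box_border R c b <= _).
  apply: ler_sum => b _; rewrite ler_wpM2r ?box_border_ge0//.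
  by have /andP[] := q2 b.
rewrite -mulr_sumr; apply: le_trans (_ : 2 * u * ((4 * d)%:R * L%:R ^+ d.-1) <= _).
  by rewrite ler_wpM2l ?mulr_ge0 ?(ltW u0)// box_border_sum.
have -> : u = L%:R^-1 * (L%:R ^+ d.-1)^-1.
  by rewrite /u -invfM -exprS prednK.
rewrite (_ : (8 * d)%:R = 2 * (4 * d)%:R); last by rewrite -natrM; congr (_%:R); lia.
by rewrite le_eqVlt; apply/orP; left; apply/eqP; field; rewrite expf_neq0 ?gt_eqF.
Qed.

Let adj_mean i : \sum_j n%:R^-1 * `|h i j - box_band R (cc i) (cc j)|
  <= (8 * d)%:R / L%:R.
Proof.
apply: le_trans (border_mean (cc i)).
rewrite -(sum_lump cc n%:R^-1 (box_border R (cc i))); apply: ler_sum => j _.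
by rewrite ler_wpM2l ?invr_ge0// /h mxE adjacency_band.
Qed.

Let dn i := row_sum (adjacency 1 p n) i / n%:R.

Let dn_delta i : `|dn i - delta (cc i)| <= e.
Proof.
have -> : dn i - delta (cc i) =
    \sum_j n%:R^-1 * (h i j - box_band R (cc i) (cc j)) +
    \sum_b (q b - u) * box_band R (cc i) b.
  rewrite /dn /row_sum mulr_suml; under eq_bigr do rewrite mulrC.
  under [X in _ = X + _]eq_bigr do rewrite mulrBr.
  under [X in _ = _ + X]eq_bigr do rewrite mulrBl.
  rewrite !sumrB (sum_lump cc n%:R^-1 (box_band R (cc i))) addrA subrK.
  by [].
apply: le_trans (ler_normD _ _) _; rewrite /e natrD mulrDl; apply: lerD.
  apply: le_trans (ler_norm_sum _ _ _) _; apply: le_trans (adj_mean i).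
  by apply: ler_sum => j _; rewrite normrM ger0_norm ?invr_ge0.
apply: le_trans (ler_norm_sum _ _ _) _.
apply: le_trans (_ : \sum_(b : T) u / L%:R <= _).
  apply: ler_sum => b _; rewrite normrM -[leRHS]mulr1.
  by apply: ler_pM => //; rewrite ger0_norm ?box_band_ge0 ?box_band_le1.
by rewrite sumr_const -[leLHS]mulr_natl mulrA cardT.
Qed.

Let dn_ge i : C^-1 <= dn i.
Proof.
have h1 := delta_ge (cc i); have /ler_normlP[h2 _] := dn_delta i.
have eC : e <= C^-1.
  rewrite -[C^-1]mul1r ler_pdivlMr// mulrC; move: e_small; rewrite -mulrA.
  by move: (C * e) => x; lra.
by move: h1 h2 eC; move: (C^-1) (delta _) (dn i) e => a b c z; lra.
Qed.

Let invC (x : R) : C^-1 <= x -> 0 < x /\ 0 <= x^-1 <= C.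
Proof.
move=> Cx; have x0 : 0 < x by apply: lt_le_trans Cx; rewrite invr_gt0.
by split=> //; rewrite invr_ge0 (ltW x0)/= -[leRHS]invrK lef_pV2 ?posrE ?invr_gt0.
Qed.

Let delta_ge' c : C^-1 <= delta c.
Proof.
have Ci : 0 < C^-1 by rewrite invr_gt0.
by move: (delta_ge c) Ci; move: (delta c) (C^-1) => a b; lra.
Qed.

Let h01 i j : 0 <= h i j <= 1.
Proof. by rewrite /h mxE ler0n lern1; case: (sup_dist _ _ <= 1). Qed.

Let V i j := h i j / row_sum (adjacency 1 p n) i.
Let B i j := n%:R^-1 * (box_band R (cc i) (cc j) / delta (cc i)).

Let VE i j : V i j = n%:R^-1 * (h i j / dn i).
Proof.
rewrite /V /dn; field; rewrite ?gt_eqF ?adjacency_degree_gt0//.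
Qed.

(** [V] is the walk on the sample and [B] the same walk with adjacency and degrees
read off from the cells. *)
Lemma graph_trace_dist m :
  `|ktrace V m.+2 - ktrace B m.+2| <= m.+2%:R * C ^+ m.+1 * (2 * C ^+ 2 * e).
Proof.
have e0 : 0 <= e by rewrite divr_ge0.
have D : \sum_i \sum_j `|V i j - B i j| <= n%:R * (2 * C ^+ 2 * e).
  apply: le_trans (_ : \sum_(i < n) (2 * C ^+ 2 * e) <= _); last first.
    by rewrite sumr_const card_ord [leRHS]mulr_natl.
  apply: ler_sum => i _.
  have [dn0 /andP[_ dnC]] := invC (dn_ge i).
  have [de0 /andP[_ deC]] := invC (delta_ge' (cc i)).
  apply: le_trans (_ : \sum_j (C * (n%:R^-1 * `|h i j - box_band R (cc i) (cc j)|) +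
     n%:R^-1 * (C ^+ 2 * e)) <= _).
    apply: ler_sum => j _.
    have -> : V i j - B i j = n%:R^-1 * ((dn i)^-1 * (h i j - box_band R (cc i) (cc j)))
      + n%:R^-1 * (box_band R (cc i) (cc j) *
          ((dn i)^-1 * (delta (cc i))^-1 * (delta (cc i) - dn i))).
      by rewrite VE /B; field; rewrite !gt_eqF.
    apply: le_trans (ler_normD _ _) _; apply: lerD.
      rewrite normrM ger0_norm ?invr_ge0// mulrCA ler_wpM2l ?invr_ge0//.
      by rewrite normrM ger0_norm ?invr_ge0 ?(ltW dn0)// ler_wpM2r.
    rewrite normrM ger0_norm ?invr_ge0// ler_wpM2l ?invr_ge0//.
    rewrite normrM -[leRHS]mul1r; apply: ler_pM => //.
      by rewrite ger0_norm ?box_band_ge0 ?box_band_le1.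
    rewrite normrM; apply: ler_pM => //; last by rewrite distrC.
    rewrite ger0_norm ?mulr_ge0 ?invr_ge0 ?(ltW dn0) ?(ltW de0)// expr2.
    by apply: ler_pM => //; rewrite invr_ge0 ltW.
  rewrite big_split/= -mulr_sumr sumr_const card_ord -[X in _ + X]mulr_natl.
  rewrite mulrA divff ?gt_eqF// mul1r.
  apply: le_trans (_ : C * e + C ^+ 2 * e <= _).
    rewrite lerD2r ler_wpM2l ?(ltW C0)//; apply: le_trans (adj_mean i) _.
    by rewrite /e ler_wpM2r ?invr_ge0// ler_nat leq_addr.
  have : C * e <= C ^+ 2 * e by rewrite ler_wpM2r// expr2 ler_peMr// ltW.
  by lra.
have Vb i j : `|V i j| <= C / n%:R.
  have [dn0 /andP[_ dnC]] := invC (dn_ge i); have /andP[h0 h1] := h01 i j.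
  rewrite VE ger0_norm; last by rewrite !mulr_ge0 ?invr_ge0 ?(ltW dn0).
  rewrite mulrC ler_wpM2r ?invr_ge0// -[leRHS]mul1r; apply: ler_pM => //.
  by rewrite invr_ge0 ltW.
have Bb i j : `|B i j| <= C / n%:R.
  have [dn0 /andP[_ dnC]] := invC (delta_ge' (cc i)).
  rewrite /B ger0_norm; last first.
    by rewrite !mulr_ge0 ?invr_ge0 ?(ltW dn0) ?box_band_ge0.
  rewrite mulrC ler_wpM2r ?invr_ge0// -[leRHS]mul1r; apply: ler_pM => //.
  - exact: box_band_ge0.
  - by rewrite invr_ge0 ltW.
  - exact: box_band_le1.
have cn0 : 0 <= C / n%:R by rewrite divr_ge0// ltW.
have cnC : C / n%:R * #|'I_n|%:R <= C by rewrite card_ord divfK// gt_eqF.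
apply: le_trans (ktrace_dist cn0 cnC Vb Bb m) _.
apply: le_trans (_ : m.+2%:R * (C / n%:R) * C ^+ m * (n%:R * (2 * C ^+ 2 * e)) <= _).
  by rewrite ler_wpM2l// !mulr_ge0 ?exprn_ge0 ?(ltW C0).
rewrite le_eqVlt; apply/orP; left; apply/eqP; rewrite (exprS _ m).
by field; rewrite gt_eqF.
Qed.

(** By lumping, the trace of [B] is that of a kernel on the cells weighted by the
empirical frequencies, which are close to uniform. *)
Lemma cell_trace_dist m :
  `|ktrace B m.+2 - ktrace (band_kernel R (N := N)) m.+2 ^+ d| <=
  m.+2%:R * (2 * C) ^+ m * (2 * C ^+ 2 / L%:R).
Proof.
pose M a b := box_band R a b / delta a.
have -> : ktrace B m.+2 = ktrace (fun a b => M a b * q b) m.+2.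
  exact: (ktrace_lump cc M n%:R^-1).
rewrite -ktrace_prod.
have -> : ktrace (fun x y : T => \prod_l band_kernel R (x l) (y l)) m.+2 =
    ktrace (fun a b => M a b * u) m.+2.
  apply: eq_ktrace => a b; rewrite /M /delta -mulr_sumr box_band_sum /band_kernel.
  rewrite prodf_div /box_band.
  by rewrite invfM [u^-1 * _]mulrC mulrA divfK// gt_eqF.
have Mb a b : `|M a b| <= C.
  have [dn0 /andP[_ dnC]] := invC (delta_ge' a).
  rewrite /M ger0_norm; last by rewrite divr_ge0 ?box_band_ge0// ltW.
  rewrite -[leRHS]mul1r; apply: ler_pM; rewrite ?box_band_ge0 ?box_band_le1//.
  by rewrite invr_ge0 ltW.
have c0 : 0 <= C * (2 * u) by rewrite !mulr_ge0// ltW.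
have cC : C * (2 * u) * #|{: T}|%:R <= 2 * C.
  by rewrite -mulrA -mulrA (mulrC u) cardT mulr1 mulrC.
have b1 a b : `|M a b * q b| <= C * (2 * u).
  rewrite normrM; apply: ler_pM => //; have /andP[q0 qu] := q2 b.
  by rewrite ger0_norm.
have b2 a b : `|M a b * u| <= C * (2 * u).
  rewrite normrM; apply: ler_pM => //; rewrite ger0_norm ?(ltW u0)//.
  by have := u0; lra.
apply: le_trans (ktrace_dist c0 cC b1 b2 m) _.
apply: le_trans (_ : m.+2%:R * (C * (2 * u)) * (2 * C) ^+ m *
    \sum_(a : T) \sum_(b : T) C * (u / L%:R) <= _).
  rewrite ler_wpM2l ?mulr_ge0 ?exprn_ge0 ?mulr_ge0 ?(ltW C0) ?(ltW u0)//.
  apply: ler_sum => a _; apply: ler_sum => b _.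
  by rewrite -mulrBr normrM ler_pM.
have sT (x : R) : \sum_(a : T) x = #|{: T}|%:R * x.
  by rewrite sumr_const mulr_natl.
rewrite !sT.
have -> : m.+2%:R * (C * (2 * u)) * (2 * C) ^+ m *
  (#|{: T}|%:R * (#|{: T}|%:R * (C * (u / L%:R)))) =
  (#|{: T}|%:R * u) * (#|{: T}|%:R * u) *
  (m.+2%:R * (2 * C) ^+ m * (2 * C ^+ 2 / L%:R)) by ring.
by rewrite cardT !mul1r.
Qed.

Lemma graph_power_sum_dist m :
  `|\sum_(x <- spectrum (normalized_adjacency 1 p n)) x ^+ m.+2 -
    (\sum_(x <- band_spectrum R N) x ^+ m.+2) ^+ d| <=
  (m.+2%:R * C ^+ m.+1 * (2 * C ^+ 2 * (8 * d + 1)%:R) +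
   m.+2%:R * (2 * C) ^+ m * (2 * C ^+ 2)) / L%:R.
Proof.
rewrite normalized_adjacencyE normalize_mx_power_sum; last 2 first.
- exact: adjacency_sym.
- exact: adjacency_degree_gt0.
rewrite band_power_sum -(subrK (ktrace B m.+2) (ktrace _ _)) -addrA.
apply: le_trans (ler_normD _ _) _; rewrite mulrDl; apply: lerD.
  by apply: le_trans (graph_trace_dist m) _; rewrite /e !mulrA.
by apply: le_trans (cell_trace_dist m) _; rewrite !mulrA.
Qed.

End graph_comparison.

(** * Equidistributed samples *)

Section asymptotics.
Variables (R : realType) (d : nat).
Hypothesis d0 : (0 < d)%N.

(** The shift by 3 is the condition of [band_spectrumP]. *)
Definition model_spectrum (g : nat) : seq R :=
  tensor_spectrum (band_spectrum R (400 * (g + 3))) d.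

Definition equidistributed (p : nat -> d.-tuple R) :=
  forall N (c : {ffun 'I_d -> 'I_N.*2.+1}),
    (fun n => cell_frequency n p c) @ \oo --> ((N.*2.+1%:R : R) ^+ d)^-1.

(** For a fixed number of cells the frequencies are as close to uniform as
required once [n] is large, so the distance is eventually of the order of the
inverse number of cells. *)
Lemma spectrum_close_to_model (p : nat -> d.-tuple R) :
  (forall i l, `|tnth (p i) l| <= 1) -> equidistributed p ->
  forall m (e : R), 0 < e -> \forall g \near \oo, \forall n \near \oo,
    `|\sum_(x <- spectrum (normalized_adjacency 1 p n)) x ^+ m.+2 -
      \sum_(x <- model_spectrum g) x ^+ m.+2| <= e.
Proof.
move=> p1 peq m e e0.
pose C : R := 2 ^+ d.+1.
pose K : R := m.+2%:R * C ^+ m.+1 * (2 * C ^+ 2 * (8 * d + 1)%:R) +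
   m.+2%:R * (2 * C) ^+ m * (2 * C ^+ 2).
near=> g.
pose N := (400 * (g + 3))%N; pose L : R := N.*2.+1%:R.
have L0 : 0 < L by [].
have gL : g%:R <= L by rewrite ler_nat /N; lia.
have KL : K / L <= e.
  rewrite ler_pdivrMr// mulrC -ler_pdivrMr//.
  by apply: le_trans gL; near: g; exact: nbhs_infty_ger.
have small : 2 * C * ((8 * d + 1)%:R / L) <= 2.
  rewrite mulrA ler_pdivrMr// -ler_pdivrMl//.
  by apply: le_trans gL; near: g; exact: nbhs_infty_ger.
have u0 : 0 < (L ^+ d)^-1 / L by rewrite divr_gt0// invr_gt0 exprn_gt0.
have fr : \forall n \near \oo, forall c : {ffun 'I_d -> 'I_N.*2.+1},
    `|cell_frequency n p c - (L ^+ d)^-1| <= (L ^+ d)^-1 / L.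
  apply: filter_forall => c.
  have /cvgrPdist_le/(_ _ u0) h := peq N c.
  by near=> n; rewrite distrC; near: n.
near=> n.
have n0 : (0 < n)%N by near: n; exact: nbhs_infty_gt.
rewrite tensor_power_sum; apply: le_trans KL.
apply: (graph_power_sum_dist (N := N)) => //.
by near: n.
Unshelve. all: end_near. Qed.

(** The hypothesis makes [a] a Cauchy sequence, so that no limit has to be
computed. *)
Lemma common_limit (a b : nat -> R) :
  (forall e : R, 0 < e -> \forall g \near \oo, \forall n \near \oo,
     `|a n - b g| <= e) ->
  exists l : R, a @ \oo --> l /\ b @ \oo --> l.
Proof.
move=> ab.
have /cvg_ex[l al] : cvgn a.
  apply/cauchy_cvgP; apply: cauchy_exP => e e0.
  have e20 : 0 < e / 2 by rewrite divr_gt0.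
  near \oo => g; exists (b g).
  have near1 : \forall n \near \oo, `|a n - b g| <= e / 2.
    by near: g; exact: ab.
  near=> n; rewrite /= /ball/= distrC.
  apply: le_lt_trans (_ : e / 2 < e); last by lra.
  by near: n.
exists l; split => //; apply/cvgrPdist_le => e e0.
have e20 : 0 < e / 2 by rewrite divr_gt0.
have /cvgrPdist_le/(_ _ e20) al2 := al.
have ab2 := ab _ e20.
near=> g.
have near1 : \forall n \near \oo, `|a n - b g| <= e / 2 by near: g.
near \oo => n; rewrite -(subrK (a n) l) -addrA (splitr e).
by apply: le_trans (ler_normD _ _) _; apply: lerD; near: n.
Unshelve. all: end_near. Qed.

Lemma equidistributed_moments (p : nat -> d.-tuple R) :
  (forall i l, `|tnth (p i) l| <= 1) -> equidistributed p ->
  exists tau, has_moments tau (fun n => spectrum (normalized_adjacency 1 p n)) /\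
    has_moments tau model_spectrum.
Proof.
move=> p1 peq.
have h m := common_limit (spectrum_close_to_model p1 peq m).
have [tau htau] := choice h.
by exists tau; split => m; have [] := htau m.
Qed.

End asymptotics.

(** * Strong law of large numbers for events *)

Section slln.
Context {R : realType} {dO : measure_display} {Omega : measurableType dO}.
Variable P : probability Omega R.

Lemma sqrt_exists n : exists2 k, (k ^ 2 <= n)%N & (n < k.+1 ^ 2)%N.
Proof.
elim: n => [|n [k k1 k2]]; first by exists 0%N.
have [h|h] := ltnP n.+1 (k.+1 ^ 2); first by exists k => //; exact: leqW.
by exists k.+1 => //; move: k2 h; rewrite !expnS !expn0; nia.
Qed.

(** Between consecutive squares the sum grows by at most [2 k], which is small
compared with [k ^ 2]. *)
Lemma cvg_of_squares (S : nat -> R) (p : R) : 0 <= p <= 1 ->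
  (forall n, S n <= S n.+1 <= S n + 1) ->
  (fun k => (S (k.+1 ^ 2)%N - (k.+1 ^ 2)%:R * p) / (k.+1 ^ 2)%:R) @ \oo --> (0 : R) ->
  (fun n => S n / n%:R) @ \oo --> p.
Proof.
move=> /andP[p0 p1] Sinc S0; apply/cvgrPdist_le => e e0.
have e20 : 0 < e / 2 by rewrite divr_gt0.
have /cvgrPdist_le/(_ _ e20)[k0 _ hk0] := S0.
have Sle m k : S m <= S (m + k)%N <= S m + k%:R.
  elim: k => [|k /andP[h1 h2]]; first by rewrite addn0 addr0 lexx.
  have /andP[h3 h4] := Sinc (m + k)%N; rewrite addnS -natr1.
  by apply/andP; split; lra.
(* From k >= 8 / e on, the growth 4 k between squares is at most (e / 2) k^2. *)
pose k1 := maxn k0 (Num.truncn (8 / e)).+1.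
near=> n.
have kn : (k1.+1 ^ 2 <= n)%N by near: n; exact: nbhs_infty_ge.
have [k kl ku] := sqrt_exists n.
have k1k : (k1 < k)%N.
  rewrite -ltnS -ltn_sqr; exact: leq_ltn_trans kn ku.
have := hk0 k.-1; rewrite /= prednK; last exact: leq_ltn_trans k1k.
have k0k : (k0 <= k.-1)%N.
  by have : (k0 <= k1)%N := leq_maxl _ _; lia.
move=> /(_ k0k).
have kR : 0 < (k ^ 2)%:R :> R.
  by rewrite ltr0n sqrn_gt0; exact: leq_ltn_trans k1k.
have nR : 0 < n%:R :> R by apply: lt_le_trans kR _; rewrite ler_nat.
rewrite sub0r normrN normrM normfV (gtr0_norm kR) ler_pdivrMr//.
have := Sle (k ^ 2)%N (n - k ^ 2)%N; rewrite subnKC// natrB//.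
have nk : n%:R <= (k ^ 2)%:R + 2 * k%:R :> R.
  by rewrite -natrM -natrD ler_nat; move: ku; rewrite !expnS !expn0 !muln1; lia.
have kn' : (k ^ 2)%:R <= n%:R :> R by rewrite ler_nat.
have ek : 4 * k%:R <= e / 2 * (k ^ 2)%:R :> R.
  have : 8 / e <= k%:R.
    apply: le_trans (_ : (Num.truncn (8 / e)).+1%:R <= _); first by rewrite ltW// truncnS_gt.
    by rewrite ler_nat (leq_trans (leq_maxr k0 _))// ltnW.
  rewrite ler_pdivrMr// natrX => h.
  have : 0 <= k%:R :> R by []. 
  by nra.
rewrite !ler_norml => /andP[a1 a2] /andP[a3 a4].
have -> : p - S n / n%:R = (n%:R * p - S n) / n%:R by field; rewrite gt_eqF.
move: nk kn' ek a1 a2 a3 a4 kR nR.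
move: ((k ^ 2)%:R : R) (n%:R : R) (k%:R : R) (S n) (S (k ^ 2)%N) => K N k' s s'.
move=> nk kn' ek a1 a2 a3 a4 kR nR.
have NK : (N - K) * p <= N - K by rewrite ler_piMr// subr_ge0.
have NK0 : 0 <= (N - K) * p by rewrite mulr_ge0// subr_ge0.
have eK : e * K <= e * N by rewrite ler_wpM2l// ltW.
rewrite ler_pdivlMr// ler_pdivrMr//.
by apply/andP; split; lra.
Unshelve. all: end_near. Qed.

Variables (A : nat -> set Omega) (p : R).
Hypotheses (mA : forall i, measurable (A i)) (PA : forall i, P (A i) = p%:E).
Hypothesis PAA : forall i j, i != j -> P (A i `&` A j) = (p ^+ 2)%:E.

Let S n w : R := \sum_(i < n) \1_(A i) w.

Let mS n : measurable_fun setT (S n).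
Proof. by apply: measurable_sum => i; exact: measurable_indic. Qed.

Let p01 : 0 <= p <= 1.
Proof.
by rewrite -!lee_fin -(PA 0%N) measure_ge0 probability_le1.
Qed.

Let integral_S n : (\int[P]_w (S n w)%:E = (n%:R * p)%:E)%E.
Proof.
rewrite /S; under eq_integral do rewrite -sumEFin.
rewrite (ge0_integral_sum P measurableT (f := fun (i : 'I_n) w => (\1_(A i) w)%:E))//;
  last first.
  by move=> i; apply/measurable_EFinP; exact: measurable_indic.
rewrite (eq_bigr (fun=> p%:E)); last first.
  by move=> i _; rewrite integral_indic// setIT; exact: PA.
by rewrite sumEFin sumr_const card_ord mulr_natl.
Qed.

Let integral_S2 n :
  (\int[P]_w (S n w ^+ 2)%:E = (n%:R * p + (n%:R ^+ 2 - n%:R) * p ^+ 2)%:E)%E.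
Proof.
(* The square of the sum counts pairs, and events indexed by i != j are
   independent. *)
have S2 w : (S n w ^+ 2)%:E = (\sum_(ij : 'I_n * 'I_n)
    (\1_(A ij.1 `&` A ij.2) w)%:E)%E.
  rewrite sumEFin expr2 /S mulr_suml; congr (_%:E).
  rewrite -(pair_bigA _ (fun i j : 'I_n => \1_(A i `&` A j) w))/=; apply: eq_bigr => i _.
  by rewrite mulr_sumr; apply: eq_bigr => j _; rewrite indicI.
under eq_integral do rewrite S2.
rewrite (ge0_integral_sum P measurableT
   (f := fun (ij : 'I_n * 'I_n) w => (\1_(A ij.1 `&` A ij.2) w)%:E))//; last first.
  by move=> i; apply/measurable_EFinP; apply: measurable_indic; exact: measurableI.
rewrite (eq_bigr (fun ij : 'I_n * 'I_n => ((ij.1 == ij.2)%:R * (p - p ^+ 2) + p ^+ 2)%:E));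
  last first.
  move=> [i j] _ /=; rewrite integral_indic ?setIT//; last exact: measurableI.
  case: eqVneq => [->|ij]; first by rewrite setIid mul1r subrK; exact: PA.
  by rewrite mul0r add0r; exact: PAA.
rewrite sumEFin -(pair_bigA _ (fun i j : 'I_n => (i == j)%:R * (p - p ^+ 2) + p ^+ 2))/=.
congr (_%:E); rewrite (eq_bigr (fun=> p - p ^+ 2 + n%:R * p ^+ 2)); last first.
  move=> i _; rewrite big_split/= sumr_const card_ord mulr_natl; congr (_ + _).
  rewrite (bigD1 i)//= eqxx mul1r big1 ?addr0// => j.
  by rewrite eq_sym => /negbTE ->; rewrite mul0r.
by rewrite sumr_const card_ord -mulr_natl; ring.
Qed.

Let variance_S n :
  (\int[P]_w ((S n w - n%:R * p) ^+ 2)%:E <= n%:R%:E)%E.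
Proof.
have /andP[p0 p1] := p01.
have S0 w : 0 <= S n w by apply: sumr_ge0.
have m1 : measurable_fun setT (fun w => ((S n w - n%:R * p) ^+ 2)%:E).
  by apply/measurable_EFinP; apply: measurable_funX; apply: measurable_funB.
have m2 : measurable_fun setT (fun w => (S n w)%:E) by apply/measurable_EFinP.
have m3 : measurable_fun setT (fun w => (S n w ^+ 2)%:E).
  by apply/measurable_EFinP; apply: measurable_funX.
have c0 : 0 <= 2 * (n%:R * p) by rewrite !mulr_ge0.
(* Moving the mixed term to the left keeps all integrands nonnegative. *)
have E : (\int[P]_w ((S n w - n%:R * p) ^+ 2)%:E +
   (2 * (n%:R * p))%:E * \int[P]_w (S n w)%:E =
   \int[P]_w (S n w ^+ 2)%:E + ((n%:R * p) ^+ 2)%:E)%E.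
  rewrite -ge0_integralZl_EFin//; last by move=> w _; rewrite lee_fin.
  rewrite -ge0_integralD//; last 3 first.
  - by move=> w _; rewrite lee_fin sqr_ge0.
  - by move=> w _; rewrite lee_fin mulr_ge0.
  - by apply: measurable_funeM.
  have -> : ((n%:R * p) ^+ 2)%:E = (\int[P]_w (cst ((n%:R * p) ^+ 2)%:E w))%E.
    rewrite integral_cst// -[LHS]mule1; congr (_ * _)%E.
    by apply/esym; exact: probability_setT.
  rewrite -ge0_integralD//; last 2 first.
  - by move=> w _; rewrite lee_fin sqr_ge0.
  - by move=> w _; rewrite lee_fin sqr_ge0.
  by apply: eq_integral => w _; rewrite /= -!EFinM -!EFinD; congr (_%:E); ring.
move: E; rewrite integral_S integral_S2 -EFinM -EFinD => E.
have : (\int[P]_w ((S n w - n%:R * p) ^+ 2)%:E = (n%:R * (p - p ^+ 2))%:E)%E.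
  rewrite -[LHS](@addeK _ (2 * (n%:R * p) * (n%:R * p))%:E)//.
  by rewrite E -EFinD; congr (_%:E); ring.
by move=> ->; rewrite lee_fin ler_piMr//; nra.
Qed.

(** Along squares the mean square deviations are at most [1 / (k + 1) ^ 2], hence
summable; so almost surely the series of squared deviations converges and its
terms tend to 0. *)
Lemma frequency_cvg : {ae P, forall w, (fun n => S n w / n%:R) @ \oo --> p}.
Proof.
pose sq k := (k.+1 ^ 2)%N.
pose Z k w := ((S (sq k) w - (sq k)%:R * p) / (sq k)%:R) ^+ 2.
have sq0 k : 0 < (sq k)%:R :> R by rewrite ltr0n expn_gt0.
have mZ k : measurable_fun setT (fun w => (Z k w)%:E).
  apply/measurable_EFinP; apply: measurable_funX; apply: measurable_funM => //.
  exact: measurable_funB.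
have Z0 k w : 0 <= Z k w by exact: sqr_ge0.
have intZ k : (\int[P]_w (Z k w)%:E <= ((sq k)%:R^-1)%:E)%E.
  have -> : (\int[P]_w (Z k w)%:E = ((sq k)%:R ^- 2)%:E *
      \int[P]_w ((S (sq k) w - (sq k)%:R * p) ^+ 2)%:E)%E.
    have c0 : 0 <= (sq k)%:R ^- 2 :> R by rewrite invr_ge0 sqr_ge0.
    rewrite -(ge0_integralZl_EFin P measurableT _ _ c0); last 2 first.
    - by move=> w _; rewrite lee_fin sqr_ge0.
    - by apply/measurable_EFinP; apply: measurable_funX; apply: measurable_funB.
    by apply: eq_integral => w _; rewrite /Z expr_div_n EFinM muleC.
  apply: le_trans (_ : ((sq k)%:R ^- 2)%:E * (sq k)%:R%:E <= _)%E.
    by apply: lee_wpmul2l; [rewrite lee_fin invr_ge0 sqr_ge0|exact: variance_S].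
  by rewrite -EFinM lee_fin expr2 invfM -mulrA mulVf ?mulr1// gt_eqF.
have sum2 : (\sum_(0 <= k <oo) ((sq k)%:R^-1)%:E <= 2%:E :> \bar R)%E.
  apply: lime_le.
    by apply: is_cvg_nneseries => k _ _; rewrite lee_fin invr_ge0.
  near=> n; rewrite sumEFin lee_fin big_mkord.
  suff h m : \sum_(i < m.+1) (sq i)%:R^-1 <= 2 - m.+1%:R^-1 :> R.
    apply: le_trans (_ : \sum_(i < n.+1) (sq i)%:R^-1 <= _).
      by rewrite big_ord_recr/= lerDl invr_ge0.
    by apply: le_trans (h n) _; rewrite gerBl invr_ge0.
  elim: m => [|m IH]; first by rewrite big_ord1 /sq invr1; lra.
  rewrite big_ord_recr/=; apply: le_trans (lerD IH (lexx _)) _.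
  rewrite /sq natrX -[m.+2%:R]natr1; have : 1 <= m.+1%:R :> R by rewrite ler1n.
  move: (m.+1%:R : R) => x x1.
  have h : 0 <= (x + 1)^-1 * ((x + 1) * (x * (x + 1)))^-1.
    by rewrite mulr_ge0 ?invr_ge0 ?mulr_ge0//; lra.
  have -> : 2 - (x + 1)^-1 = 2 - x^-1 + ((x + 1) ^+ 2)^-1 +
      (x + 1)^-1 * (x * (x + 1))^-1 * (x + 1) * (x + 1)^-1.
    by field; apply/andP; split; rewrite gt_eqF//; lra.
  rewrite lerDl !mulr_ge0 ?invr_ge0 ?mulr_ge0//; lra.
have fin : (\int[P]_w (\sum_(0 <= k <oo) (Z k w)%:E) < +oo)%E.
  rewrite (integral_nneseries P measurableT mZ); last first.
    by move=> k w _; rewrite lee_fin.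
  apply: le_lt_trans (ltry 2); apply: le_trans sum2.
  apply: lee_nneseries => [k _ _|k _]; last exact: intZ.
  by apply: integral_ge0 => w _; rewrite lee_fin.
have : P.-integrable setT (fun w => \sum_(0 <= k <oo) (Z k w)%:E)%E.
  apply/integrableP; split.
    apply: (ge0_emeasurable_sum (P := xpredT)) => // k w _ _.
    by rewrite lee_fin.
  rewrite (eq_integral (fun w => \sum_(0 <= k <oo) (Z k w)%:E)%E) => [|w _].
    exact: fin.
  by rewrite gee0_abs//; apply: nneseries_ge0 => k _ _; rewrite lee_fin.
move=> /(integrable_ae measurableT); apply: filterS => w /(_ I) wfin.
apply: cvg_of_squares => //.
  by move=> n; rewrite /S big_ord_recr/= lerDl lerD2l indicE;
    case: (_ \in _); rewrite ?ler01 ?lexx.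
have : (fun k => Z k w) @ \oo --> (0 : R).
  apply: cvg_series_cvg_0; apply: nnseries_is_cvg => //.
  by rewrite ltey_eq wfin.
rewrite /Z => Zw; apply/norm_cvg0P; apply/cvgrPdist_le => e e0.
have e20 : 0 < e ^+ 2 by rewrite exprn_gt0.
have /cvgrPdist_le/(_ _ e20) near1 := Zw.
near=> k; rewrite sub0r normrN normr_id -ler_sqr ?nnegrE ?(ltW e0)//.
rewrite real_normK ?num_real//.
have : `|0 - ((S (sq k) w - (sq k)%:R * p) / (sq k)%:R) ^+ 2| <= e ^+ 2.
  by near: k.
by rewrite sub0r normrN ger0_norm ?sqr_ge0.
Unshelve. all: end_near. Qed.
End slln.

(** * Almost sure equidistribution of uniform samples *)

Section uniform_boxes.
Variable R : realType.

Lemma uniform_prob_itv (s t : R) : -1 <= s -> s <= t -> t <= 1 ->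
  uniform_prob (@ltN11R R) `[s, t[%classic = ((t - s) / 2)%:E.
Proof.
move=> s1 st t1; have mI : measurable (`[s, t[%classic : set R) by [].
have mf : measurable_fun [set: measurableTypeR R]
    (fun x => (\1_(`[s, t[%classic : set R) x)%:E : \bar R).
  by apply/measurable_EFinP; exact: measurable_indic.
have f0 (x : measurableTypeR R) : (0%:E <= (\1_(`[s, t[%classic : set R) x)%:E :> \bar R)%E.
  by rewrite lee_fin.
have := integral_uniform (@ltN11R R) mf f0.
rewrite integral_indic// setIT => ->.
rewrite integral_indic// (_ : _ `&` _ = `[s, t[%classic); last first.
  apply/setIidPl => x; rewrite /= !in_itv/= => /andP[sx xt].
  by apply/andP; split; lra.
have leb : lebesgue_measure (`[s, t[%classic : set R) = (t - s)%:E.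
  rewrite lebesgue_measure_itv/= lte_fin; case: ltP => st'; first by rewrite EFinB.
  by have -> : t = s by [apply/le_anti; rewrite st st']; rewrite subrr.
transitivity ((1 - -1)^-1%:E * (t - s)%:E)%E; first by congr (_ * _)%E; exact: leb.
by rewrite -EFinM opprK mulrC.
Qed.

Definition tuple_box d (J : 'I_d -> set R) : set (d.-tuple (measurableTypeR R)) :=
  [set x | forall l, J l (tnth x l)].

Lemma measurable_tuple_box d (J : 'I_d -> set R) :
  (forall l, measurable (J l : set (measurableTypeR R))) ->
  measurable (tuple_box J).
Proof.
move=> mJ; have -> : tuple_box J =
    \bigcap_(l in [set: 'I_d]) ((fun x => tnth x l) @^-1` J l).
  by apply/seteqP; split => x /= h l; [move=> _|]; exact: h.
apply: fin_bigcap_measurable => // l _.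
by rewrite -[X in measurable X]setTI; exact: measurable_tnth.
Qed.

Lemma uniform_cube_box d (J : 'I_d -> set R) (v : R) :
  (forall l, measurable (J l : set (measurableTypeR R))) ->
  (forall l, uniform_prob (@ltN11R R) (J l) = v%:E) ->
  uniform_cube d (tuple_box J) = (v ^+ d)%:E.
Proof.
elim: d J => [|d IH] J mJ vJ.
  by rewrite /= diracE mem_set// => -[].
rewrite /= /distribution/= /pushforward.
have -> : tuple_cons (d:=d) @^-1` tuple_box J =
    J ord0 `*` tuple_box (fun l => J (lift ord0 l)).
  apply/seteqP; split => -[x y] /=.
    move=> h; split => [|l]; first exact: (h ord0).
    by have := h (lift ord0 l); rewrite /tuple_cons tnthS.
  move=> [Jx Jy] l; have [l'|] := unliftP ord0 l; last first.
    by move=> ->.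
  by move=> ->; rewrite /tuple_cons tnthS; exact: Jy.
rewrite product_measure1E//; last by apply: measurable_tuple_box => l.
rewrite exprS EFinM; congr (_ * _)%E; first exact: vJ.
by apply: IH => l; [exact: mJ | exact: vJ].
Qed.


(** Half-open for every [a]: the end point 1 of the cube has probability 0, and
leaving it out treats all cells alike. *)
Definition cell_itv N (a : 'I_N.*2.+1) : set R :=
  `[2 * a%:R / N.*2.+1%:R - 1, 2 * a.+1%:R / N.*2.+1%:R - 1[%classic.

Lemma cell_itvP N (a : 'I_N.*2.+1) (x : R) : -1 <= x < 1 ->
  (cell N x == a) = (x \in cell_itv a).
Proof.
move=> /andP[x0 x1].
have L0 : 0 < N.*2.+1%:R :> R by [].
have t0 : 0 <= (x + 1) * N.*2.+1%:R / 2 by rewrite !mulr_ge0//; lra.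
have tL : (x + 1) * N.*2.+1%:R / 2 < N.*2.+1%:R.
  by rewrite ltr_pdivrMr// mulrC ltr_pM2l//; lra.
have tn : (Num.truncn ((x + 1) * N.*2.+1%:R / 2) < N.*2.+1)%N.
  by rewrite truncn_lt_nat.
rewrite /cell (minn_idPl _)// -(inj_eq val_inj)/= inordK// truncn_eq//.
have -> : (x \in cell_itv a) =
    (2 * a%:R / N.*2.+1%:R - 1 <= x < 2 * a.+1%:R / N.*2.+1%:R - 1).
  by apply/idP/idP; rewrite inE /cell_itv/= in_itv.
rewrite lerBlDr ltrBrDr ler_pdivrMr// ltr_pdivlMr//.
by rewrite ler_pdivlMr// ltr_pdivrMr// ![_ * 2]mulrC.
Qed.

Lemma uniform_cell_itv N (a : 'I_N.*2.+1) :
  uniform_prob (@ltN11R R) (cell_itv a) = (N.*2.+1%:R^-1)%:E.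
Proof.
have L0 : 0 < N.*2.+1%:R :> R by [].
have aL : a.+1%:R <= N.*2.+1%:R :> R by rewrite ler_nat.
rewrite uniform_prob_itv.
- by congr (_%:E); rewrite -natr1; field; rewrite gt_eqF.
- by rewrite lerBrDr addNr !mulr_ge0 ?invr_ge0.
- by rewrite lerB// ler_wpM2r ?invr_ge0// ler_wpM2l// ler_nat.
- by rewrite lerBlDr ler_pdivrMr//; lra.
Qed.

End uniform_boxes.

Section almost_sure_equidistribution.
Variables (R : realType) (disp : measure_display) (Omega : measurableType disp).
Variables (P : probability Omega R) (d : nat).
Variable X : nat -> {RV P >-> d.-tuple (measurableTypeR R)}.
Hypothesis hX : iid (uniform_cube d) X.

Let mX i (B : set (d.-tuple (measurableTypeR R))) : measurable B ->
  measurable (X i @^-1` B).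
Proof. by move=> mB; rewrite -[X in measurable X]setTI; exact: measurable_funP. Qed.

Lemma iid_frequency_cvg (B : set (d.-tuple (measurableTypeR R))) (v : R) :
  measurable B -> uniform_cube d B = v%:E ->
  {ae P, forall w, (fun n => \sum_(i < n) (X i w \in B)%:R / n%:R) @ \oo --> v}.
Proof.
move=> mB vB.
have PX i : P (X i @^-1` B) = v%:E by rewrite -vB -(hX.2 i B mB).
have PXX i j : i != j -> P ((X i @^-1` B) `&` (X j @^-1` B)) = (v ^+ 2)%:E.
  move=> ij; have := hX.1 [:: i; j] (fun=> B).
  rewrite /= inE ij/= big_cons big_seq1 !PX => /(_ isT (fun=> mB)).
  rewrite -EFinM -expr2 => <-.
  congr (P _); apply/seteqP; split => w /=.
    by move=> [h1 h2] k; rewrite /= !inE => /orP[/eqP->|/eqP->].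
  by move=> h; split; apply: h; rewrite /= !inE eqxx ?orbT.
have := frequency_cvg (fun i => mX i mB) PX PXX.
apply: filterS => w.
apply: cvg_trans; apply: near_eq_cvg; apply: nearW => n.
by rewrite mulr_suml; apply: eq_bigr => i _; rewrite indicE.
Qed.

Lemma iid_uniform_in_cube :
  {ae P, forall w i l, -1 <= tnth (X i w) l < 1}.
Proof.
pose B := tuple_box (fun _ : 'I_d => `[-1, 1[%classic : set R).
have mB : measurable B by apply: measurable_tuple_box.
have PB : uniform_cube d B = 1%:E.
  rewrite -(expr1n _ d); apply: uniform_cube_box => // l.
  transitivity (((1 - -1) / 2 : R)%:E); first by apply: uniform_prob_itv; lra.
  by congr (_%:E); lra.
apply: (ae_foralln (P := fun i w => forall l, -1 <= tnth (X i w) l < 1)) => i.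
have PX : P (X i @^-1` B) = 1%:E by rewrite -PB -(hX.2 i B mB).
exists (~` (X i @^-1` B)); split.
- by apply: measurableC; exact: mX.
- have := probability_setC P (mX i mB); rewrite PX subee//.
- move=> w /= nw Bw; apply: nw => l.
  by have := Bw l; rewrite /= in_itv.
Qed.

Lemma iid_uniform_equidistributed :
  {ae P, forall w, (forall i l, `|tnth (X i w) l| <= 1) /\
    equidistributed (fun i => X i w)}.
Proof.
have cells : {ae P, forall w N (c : {ffun 'I_d -> 'I_N.*2.+1}),
   (fun n => \sum_(i < n) (X i w \in tuple_box (fun l => cell_itv (R := R) (c l)))%:R / n%:R)
     @ \oo --> ((N.*2.+1%:R : R)^-1) ^+ d}.
  apply: (ae_foralln (P := fun N w => forall (c : {ffun 'I_d -> 'I_N.*2.+1}),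
    (fun n => \sum_(i < n) (X i w \in tuple_box (fun l => cell_itv (R := R) (c l)))%:R / n%:R)
     @ \oo --> ((N.*2.+1%:R : R)^-1) ^+ d)) => N.
  apply: filter_forall => c; apply: iid_frequency_cvg.
    by apply: measurable_tuple_box => l; exact: measurable_itv.
  apply: uniform_cube_box => l; first exact: measurable_itv.
  exact: uniform_cell_itv.
apply: filterS2 cells iid_uniform_in_cube => w wc w1; split.
  by move=> i l; rewrite ler_norml; have /andP[h /ltW ->] := w1 i l; rewrite h.
move=> N c; rewrite -exprVn; apply: cvg_trans (wc N c).
apply: near_eq_cvg; apply: nearW => n; rewrite /cell_frequency.
apply: eq_bigr => i _; congr ((nat_of_bool _)%:R / _).
apply/idP/idP => [/set_mem h|/eqP h].
  apply/eqP/ffunP => l; rewrite ffunE; apply/eqP.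
  by rewrite cell_itvP// mem_set.
apply/mem_set => l; apply/set_mem; rewrite -cell_itvP//.
by rewrite -h ffunE.
Qed.

End almost_sure_equidistribution.

(** * The limit theorem *)

Lemma limn_einf_ge (R : realType) (u : (\bar R)^nat) (l : \bar R) :
  (\forall n \near \oo, (l <= u n)%E) -> (l <= limn_einf u)%E.
Proof.
move=> [N _ lu]; rewrite limn_einf_lim; apply: lime_ge; first exact: is_cvg_einfs.
near=> n; apply: le_ereal_inf_tmp => _ [k /= nk <-]; apply: lu => /=.
by apply: leq_trans nk; near: n; exact: nbhs_infty_ge.
Unshelve. all: end_near. Qed.

Lemma eigenvalue_measureE (R : realType) (d : nat) (r : R) (p : nat -> d.-tuple R)
    n (I : set R) : eigenvalue_measure r p n I =
  (count (fun x => x \in I) (spectrum (normalized_adjacency r p n)))%:R%:E.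
Proof.
rewrite /eigenvalue_measure -sum1_count [X in X%:R]big_mkcond/= natr_sum -sumEFin.
by apply: eq_bigr => x _; rewrite diracE; case: (x \in I).
Qed.

Section sure_statement.
Variables (R : realType) (d : nat) (p : nat -> d.-tuple R).
Hypothesis d0 : (0 < d)%N.
Hypotheses (p1 : forall i l, `|tnth (p i) l| <= 1) (peq : equidistributed p).

Local Notation t := (model_spectrum R d).
Local Notation mu := (eigenvalue_measure 1 p).

Let szs n : size (spectrum (normalized_adjacency 1 p n)) = n.
Proof. by rewrite size_spectrum// normalized_adjacency_sym. Qed.

Lemma half_pow_count_lower (delta : R) k : 0 < delta ->
  \forall n \near \oo, ('C(d, k) <= count (fun x => x \in half_pow_itv k delta)
     (spectrum (normalized_adjacency 1 p n)))%N.
Proof.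
move=> delta0; have [tau [st tt]] := equidistributed_moments d0 p1 peq.
apply: (count_near_lower (c := 2 ^- k) st tt) => //.
apply: nearW => g.
have [u ku _] := @band_spectrumP R (g + 3) (leq_addl _ _).
exact: tensor_count ku.
Qed.

Lemma half_pow_liminf (delta : R) k : 0 < delta ->
  ('C(d, k)%:R%:E <= limn_einf (fun n => mu n (half_pow_itv k delta)))%E.
Proof.
move=> delta0; apply: limn_einf_ge; have near1 := half_pow_count_lower k delta0.
by near=> n; rewrite eigenvalue_measureE lee_fin ler_nat; near: n.
Unshelve. all: end_near. Qed.

(** If 0 lies in the interval, the count tends to infinity, and otherwise it
stabilizes. The point 0 itself cannot be an end point, as it belongs to the
exceptional set. *)
Lemma half_pow_cvg (delta : R) k : 0 < delta ->
  ~ accumulation t (2 ^- k - delta) -> ~ accumulation t (2 ^- k + delta) ->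
  cvgn (fun n => mu n (half_pow_itv k delta)).
Proof.
move=> delta0 Sa Sb; have [tau [st tt]] := equidistributed_moments d0 p1 peq.
rewrite (_ : (fun n => _) = (fun n => (count (fun x => x \in half_pow_itv k delta)
    (spectrum (normalized_adjacency 1 p n)))%:R%:E)); last first.
  by apply/funext => n; rewrite eigenvalue_measureE.
have c0 : 0 < 2 ^- k :> R by rewrite invr_gt0 exprn_gt0.
have a0 : 2 ^- k - delta != 0 by apply/eqP => a0; apply: Sa; rewrite a0; left.
have [an|ap] := ltP (2 ^- k - delta) 0.
  apply/cvg_ex; exists +oo%E.
  apply: (count_pinfty st szs (h := Num.min (delta - 2 ^- k) (2 ^- k + delta))).
    by rewrite lt_min; apply/andP; split; lra.
  move=> x; rewrite lt_min !ltr_norml => /andP[/andP[h1 h2] /andP[h3 h4]].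
  by rewrite /half_pow_itv/= in_itv/=; apply/andP; split; lra.
have {}ap : 0 < 2 ^- k - delta by rewrite lt_neqAle eq_sym a0.
have /cvg_ex[l h] : cvgn (fun n => (count (fun x => x \in half_pow_itv k delta)
    (spectrum (normalized_adjacency 1 p n)))%:R : R).
  by apply: (count_cvg st tt); rewrite //; lra.
by apply/cvg_ex; exists l%:E; apply: cvg_EFin => //; apply: nearW.
Qed.

Lemma mu_far_from_zero_cvg (I : set R) :
  I `<=` ~` `[- (3 / 10), 3 / 10]%classic -> ~ frontier I (1 / 2) ->
  mu n I @[n --> \oo] --> (\d_(1%R : R) I + d%:R%:E * \d_((1 / 2)%R : R) I)%E.
Proof.
move=> I3 fI; have [tau [st tt]] := equidistributed_moments d0 p1 peq.
apply: cvg_near_cst.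
have near1 : \forall n \near \oo, count (fun x => x \in I)
    (spectrum (normalized_adjacency 1 p n)) = ((1%R \in I) + d * ((1 / 2)%R \in I))%N.
  have rho0 : 0 < 299 / 1000 :> R by rewrite divr_gt0 ?ltr0n.
  have rho3 : 299 / 1000 < 3 / 10 :> R by lra.
  have model g : exists2 v : seq R, perm_eq (t g) (1 :: nseq d 2^-1 ++ v) &
      {in v, forall x, `|x| <= 299 / 1000}.
    have [u ku urho] := @band_spectrumP R (g + 3) (leq_addl _ _).
    by apply: (tensor_spectrumP d _ _ ku urho); lra.
  move: (299 / 1000 : R) rho0 rho3 model => rho rho0 rho3 model.
  apply: (count_half_eventually st tt rho0 rho3 _ _ I3 fI).
    by apply: nearW => g; exact: model.
  by near=> n; apply: mem1_graph_spectrum; near: n; exact: nbhs_infty_gt.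
near=> n; rewrite eigenvalue_measureE !diracE -EFinM -EFinD -natrM -natrD.
by congr (_%:R%:E); near: n.
Unshelve. all: end_near. Qed.

End sure_statement.

Theorem theorem2p2 (R : realType) (disp : measure_display)
    (Omega : measurableType disp) (P : probability Omega R)
    (d : nat) (hd : (1 <= d)%N)
    (X : nat -> {RV P >-> d.-tuple (measurableTypeR R)})
    (hX : iid (uniform_cube d) X) :
  let mu (w : Omega) (n : nat) : set R -> \bar R :=
    eigenvalue_measure 1 (fun i => X i w) n in
  exists S : set R,
  (forall eps : R, 0 < eps -> finite_set [set x | S x /\ eps <= `|x|]) /\
  {ae P, forall w,
    (forall (delta : R) (k : nat), 0 < delta -> (k <= d)%N ->
       ('C(d, k)%:R%:E <= limn_einf (fun n => mu w n (half_pow_itv k delta)))%E /\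
       (~ S (2 ^- k - delta) -> ~ S (2 ^- k + delta) ->
          cvgn (fun n => mu w n (half_pow_itv k delta)) /\
          ('C(d, k)%:R%:E <= limn (fun n => mu w n (half_pow_itv k delta)))%E))
    /\
    (forall I : set R,
       I `<=` ~` `[- (3 / 10), 3 / 10]%classic -> ~ frontier I (1 / 2) ->
       mu w n I @[n --> \oo] -->
         (\d_(1%R : R) I + d%:R%:E * \d_((1 / 2)%R : R) I)%E)}.
Proof.
move=> mu; have good := iid_uniform_equidistributed hX.
(* The exceptional set must not depend on the sample: one good sample shows that
   the power sums of the reference spectra converge, whence the finiteness. *)
have [[w0 [w01 w0eq]]|nogood] := pselect (exists w,
    (forall i l, `|tnth (X i w) l| <= 1) /\ equidistributed (fun i => X i w));
    last first.
  exists set0; split => [eps _|].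
    by rewrite (_ : [set _ | _] = set0)// -subset0 => x [].
  by apply: filterS good => w gw; case: nogood; exists w.
have [tau [_ tt]] := equidistributed_moments hd w01 w0eq.
exists (accumulation (model_spectrum R d)); split.
  by move=> eps; exact: accumulation_finite tt.
apply: filterS good => w [w1 weq]; split; last exact: mu_far_from_zero_cvg.
move=> delta k delta0 _; have lb := half_pow_liminf hd w1 weq k delta0.
split => // Sa Sb; have c := half_pow_cvg hd w1 weq delta0 Sa Sb.
by split => //; rewrite -is_cvg_limn_einfE.
Qed.
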